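(* Suppose that $\kappa_2\equiv\kappa_1-1\pmod e$ and $n\not\equiv 0\pmod e$. Then $\operatorname{im}(\chi_m)$ and $S_{((n-m),(1^m))}/\operatorname{im}(\chi_m)$ are irreducible $\mathscr H_n^\Lambda$-modules for all $m\in\{1,\dots,n-1\}$.
   Context: Let $\mathbb F$ be a field, $e\geqslant 3$ an integer, $I=\mathbb Z/e\mathbb Z$, $n\geqslant 1$ an integer and $\kappa=(\kappa_1,\kappa_2)\in I^2$. For $i,j\in I$ write $i\to j$ if $j=i+1$ and $i\leftarrow j$ if $j=i-1$. The symmetric group $\mathfrak S_n$, with $s_r=(r,r+1)$, acts on $I^n$ by place permutations. Algebra. $\mathscr H_n$ is the unital associative $\mathbb F$-algebra with generators $e(\mathbf i)$ ($\mathbf i\in I^n$), $y_1,\dots,y_n$, $\psi_1,\dots,\psi_{n-1}$ and relations: $e(\mathbf i)e(\mathbf j)=\delta_{\mathbf i,\mathbf j}e(\mathbf i)$; $\sum_{\mathbf i}e(\mathbf i)=1$; $y_re(\mathbf i)=e(\mathbf i)y_r$; $\psi_re(\mathbf i)=e(s_r\mathbf i)\psi_r$; $y_ry_s=y_sy_r$; $\psi_ry_s=y_s\psi_r$ if $s\ne r,r+1$; $\psi_r\psi_s=\psi_s\psi_r$ if $|r-s|>1$; $\psi_ry_{r+1}e(\mathbf i)=(y_r\psi_r+\delta_{i_r,i_{r+1}})e(\mathbf i)$; $y_{r+1}\psi_re(\mathbf i)=(\psi_ry_r+\delta_{i_r,i_{r+1}})e(\mathbf i)$; $\psi_r^2e(\mathbf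 i)$ equals $0$ if $i_r=i_{r+1}$, $(y_{r+1}-y_r)e(\mathbf i)$ if $i_r\to i_{r+1}$, $(y_r-y_{r+1})e(\mathbf i)$ if $i_r\leftarrow i_{r+1}$, and $e(\mathbf i)$ otherwise; $\psi_r\psi_{r+1}\psi_re(\mathbf i)$ equals $(\psi_{r+1}\psi_r\psi_{r+1}+1)e(\mathbf i)$ if $i_{r+2}=i_r\to i_{r+1}$, $(\psi_{r+1}\psi_r\psi_{r+1}-1)e(\mathbf i)$ if $i_{r+2}=i_r\leftarrow i_{r+1}$, and $\psi_{r+1}\psi_r\psi_{r+1}e(\mathbf i)$ otherwise. The cyclotomic algebra $\mathscr H_n^\Lambda$ (level 2) is the quotient of $\mathscr H_n$ by the relations $y_1^{c(i_1)}e(\mathbf i)=0$ for all $\mathbf i\in I^n$, where $c(i)=\#\{j\in\{1,2\}:\kappa_j=i\}$. Specht modules labelled by hook bipartitions. For $0\leqslant m\leqslant n$ put $\mathbf i_{((n-m),(1^m))}=(\kappa_2,\kappa_2-1,\dots,\kappa_2-m+1,\kappa_1,\kappa_1+1,\dots,\kappa_1+n-m-1)\in I^n$. $S_{((n-m),(1^m))}$ is the module generated by $z=z_{((n-m),(1^m))}$ subject only to $e(\mathbf i_{((n-m),(1^m))})z=z$, $y_rz=0$ for $1\leqslant r\leqslant n$, and $\psi_rz=0$ for all $r\in\{1,\dots,n-1\}\setminus\{m\}$; it is an $\mathscr H_n^\Lambda$-module. For $1\leqslant a_1<\dots<a_m\leqslant n$ define $v(a_1,\dots,a_m)=(\psi_{a_1-1}\cdots\psi_1)(\psi_{a_2-1}\cdots\psi_2)\cdots(\psi_{a_m-1}\cdots\psi_m)z$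 (indices decreasing in each factor; the factor is $1$ if $a_j=j$). These form an $\mathbb F$-basis (standard basis) of $S_{((n-m),(1^m))}$. The Specht module $S_{((n-m,1^m),\varnothing)}$. For $0\leqslant m\leqslant n-1$ put $\mathbf j=(\kappa_1,\kappa_1-1,\dots,\kappa_1-m,\kappa_1+1,\kappa_1+2,\dots,\kappa_1+n-m-1)\in I^n$. $S_{((n-m,1^m),\varnothing)}$ is the module generated by $z=z_{((n-m,1^m),\varnothing)}$ subject only to $e(\mathbf j)z=z$, $y_rz=0$ for $1\leqslant r\leqslant n$, $\psi_rz=0$ for $r\in\{1,\dots,n-1\}\setminus\{m+1\}$, and, if $m\leqslant n-2$, $\psi_1\psi_2\cdots\psi_{m+1}z=0$; it is an $\mathscr H_n^\Lambda$-module. Homomorphism. When $\kappa_2\equiv\kappa_1-1\pmod e$ and $1\leqslant m\leqslant n-1$, $\chi_m:S_{((n-m,1^m),\varnothing)}\to S_{((n-m),(1^m))}$ is the (well-defined) $\mathscr H_n^\Lambda$-homomorphism with $\chi_m(z_{((n-m,1^m),\varnothing)})=v(2,3,\dots,m+1)$. *)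

(* Defs.v *)
From HB Require Import structures.
From mathcomp Require Import all_boot all_order all_algebra.
From mathcomp Require Import finmap boolp monalg.

Set Implicit Arguments.
Unset Strict Implicit.
Unset Printing Implicit Defensive.

Import GRing.Theory.

Local Open Scope ring_scope.
Local Open Scope quotient_scope.

Section Submodules.
Variables (R : pzRingType) (M : lmodType R).

Inductive span_spec (X : M -> Prop) : M -> Prop :=
| span_gen x of X x : span_spec X x
| span_zero : span_spec X 0
| span_comb a x y of span_spec X x & span_spec X y : span_spec X (a *: x + y).

(* The submodule of M generated by X. *)
Definition span (X : M -> Prop) : {pred M} := fun x => `[< span_spec X x >].

Fact span_closed X : submod_closed (span X).
Proof.
split=> [|a x y /asboolP Xx /asboolP Xy]; apply/asboolP; first exact: span_zero.
exact: span_comb.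
Qed.

HB.instance Definition _ X :=
  GRing.isSubmodClosed.Build R M (span X) (span_closed X).

Definition submod (N : submodClosed M) : Type := {x : M | x \in N}.

HB.instance Definition _ (N : submodClosed M) := SubChoice.on (submod N).
HB.instance Definition _ (N : submodClosed M) :=
  [SubChoice_isSubLmodule of submod N by <:].

Lemma submod_oppE (N : submodClosed M) x : (- x \in N) = (x \in N).
Proof.
by apply/idP/idP=> /(rpredZ (-1)); rewrite ?scalerN scaleN1r ?opprK.
Qed.

(* N as an additive subgroup: submodClosed does not record closure under -.   *)
Definition subgroup_of (N : submodClosed M) : {pred M} := fun x => x \in N.

Fact subgroup_of_closed N : zmod_closed (subgroup_of N).
Proof.
split=> [|x y Nx Ny]; first exact: (rpred0 N).
by apply: (rpredD Nx); rewrite submod_oppE.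
Qed.

HB.instance Definition _ N :=
  GRing.isZmodClosed.Build M (subgroup_of N) (subgroup_of_closed N).

Definition modquot (N : submodClosed M) : Type := Quotient.quot (subgroup_of N).

Section ModQuot.
Variable N : submodClosed M.

HB.instance Definition _ := GRing.Zmodule.on (modquot N).
HB.instance Definition _ := Quotient.on (modquot N).

Definition modquot_pi (x : M) : modquot N := \pi_(Quotient.quot (subgroup_of N)) x.

Lemma modquot_eq x y : modquot_pi x = modquot_pi y <-> x - y \in N.
Proof.
by rewrite /modquot_pi; split=> [/eqP|h]; [|apply/eqP]; rewrite -Quotient.idealrBE.
Qed.

Lemma modquot_ind (P : modquot N -> Prop) :
  (forall x, P (modquot_pi x)) -> forall u, P u.
Proof. by move=> h u; rewrite -[u](@reprK _ (Quotient.quot (subgroup_of N))); apply: h. Qed.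

Lemma modquot_repr x : x - repr (modquot_pi x) \in N.
Proof. by apply/modquot_eq; rewrite {2}/modquot_pi reprK. Qed.

Lemma modquot_piD x y : modquot_pi (x + y) = modquot_pi x + modquot_pi y.
Proof. exact: (raddfD (\pi_(Quotient.quot (subgroup_of N)))). Qed.

Definition modquot_scale (a : R) (u : modquot N) : modquot N :=
  modquot_pi (a *: repr u).

Lemma modquot_scaleE a x : modquot_scale a (modquot_pi x) = modquot_pi (a *: x).
Proof.
apply/modquot_eq; rewrite -scalerBr; apply: rpredZ.
by rewrite -opprB submod_oppE modquot_repr.
Qed.

Fact modquot_scaleA a b u :
  modquot_scale a (modquot_scale b u) = modquot_scale (a * b) u.
Proof.
by elim/modquot_ind: u => x; rewrite !modquot_scaleE scalerA.
Qed.

Fact modquot_scale1 : left_id 1 modquot_scale.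
Proof. by elim/modquot_ind=> x; rewrite modquot_scaleE scale1r. Qed.

Fact modquot_scaleDr : right_distributive modquot_scale +%R.
Proof.
move=> a; elim/modquot_ind=> x; elim/modquot_ind=> y.
by rewrite -modquot_piD !modquot_scaleE scalerDr modquot_piD.
Qed.

Fact modquot_scaleDl u : {morph modquot_scale^~ u : a b / a + b}.
Proof.
move=> a b; elim/modquot_ind: u => x.
by rewrite !modquot_scaleE scalerDl modquot_piD.
Qed.

HB.instance Definition _ := GRing.Zmodule_isLmodule.Build R (modquot N)
  modquot_scaleA modquot_scale1 modquot_scaleDr modquot_scaleDl.

End ModQuot.

Definition irreducible_module : Prop :=
  (exists x : M, x != 0) /\
  forall N : submodClosed M,
    (forall x, x \in N -> x = 0) \/ (forall x, x \in N).

End Submodules.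

Section Image.
Variables (R : pzRingType) (M1 M2 : lmodType R) (f : {linear M1 -> M2}).

Definition im : {pred M2} := fun y => `[< exists x, f x = y >].

Fact im_closed : submod_closed im.
Proof.
split=> [|a _ _ /asboolP[x <-] /asboolP[y <-]]; apply/asboolP.
  by exists 0; rewrite linear0.
by exists (a *: x + y); rewrite linearP.
Qed.

HB.instance Definition _ := GRing.isSubmodClosed.Build R M2 im im_closed.

End Image.

(* The left module with one generator z, subject only to the relations        *)
(* a z = b z for a, b with rel a b; presmod_gen is z.                         *)
Section PresentedModule.
Variables (R : pzRingType) (rel : R -> R -> Prop).

Definition presmod : lmodType R :=
  modquot (span (fun x : R^o => exists a b, rel a b /\ x = a - b)).

Definition presmod_gen : presmod := modquot_pi _ (1 : R^o).

End PresentedModule.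

(* A unital associative F-algebra, given by the central morphism a |-> a.1.   *)
(* Unlike that of algType, this notion includes the zero algebra.             *)
HB.mixin Record PzRing_isAlgebra (F : fieldType) A of GRing.PzRing A := {
  scalar : {rmorphism F -> A};
  scalar_central : forall a x, GRing.comm (scalar a) x
}.
#[short(type="pzAlgType")]
HB.structure Definition PzAlgebra (F : fieldType) :=
  {A of GRing.PzRing A & PzRing_isAlgebra F A}.

(* The quotient of the algebra A by the relations a = b for rel a b. A        *)
(* two-sided ideal is automatically stable under scalars, as A is unital.     *)
Section PresentedAlgebra.
Variables (F : fieldType) (A : pzAlgType F) (rel : A -> A -> Prop).

Inductive ideal_spec : A -> Prop :=
| ideal_gen a b of rel a b : ideal_spec (a - b)
| ideal_zero : ideal_spec 0
| ideal_add x y of ideal_spec x & ideal_spec y : ideal_spec (x + y)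
| ideal_mul a x b of ideal_spec x : ideal_spec (a * x * b).

Definition ideal : {pred A} := fun x => `[< ideal_spec x >].

Fact ideal_mull a x : x \in ideal -> a * x \in ideal.
Proof.
by move=> /asboolP h; apply/asboolP; rewrite -[_ * _]mulr1; apply: ideal_mul.
Qed.

Fact ideal_mulr a x : x \in ideal -> x * a \in ideal.
Proof.
by move=> /asboolP h; apply/asboolP; rewrite -[x]mul1r; apply: ideal_mul.
Qed.

Fact ideal_closed : zmod_closed ideal.
Proof.
split=> [|x y /asboolP hx hy]; apply/asboolP; first exact: ideal_zero.
apply: ideal_add => //; apply/asboolP; rewrite -mulN1r.
exact: ideal_mull.
Qed.

HB.instance Definition _ := GRing.isZmodClosed.Build A ideal ideal_closed.

Definition presalg : Type := Quotient.quot ideal.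

HB.instance Definition _ := GRing.Zmodule.on presalg.

Definition presalg_pi (x : A) : presalg := \pi_(Quotient.quot ideal) x.

Lemma presalg_eq x y : presalg_pi x = presalg_pi y <-> x - y \in ideal.
Proof.
by rewrite /presalg_pi; split=> [/eqP|h]; [|apply/eqP]; rewrite -Quotient.idealrBE.
Qed.

Lemma presalg_rel a b : rel a b -> presalg_pi a = presalg_pi b.
Proof. by move=> h; apply/presalg_eq/asboolP/ideal_gen. Qed.

Lemma presalg_ind (P : presalg -> Prop) :
  (forall x, P (presalg_pi x)) -> forall u, P u.
Proof. by move=> h u; rewrite -[u](@reprK _ (Quotient.quot ideal)); apply: h. Qed.

Fact presalg_pi_zmod : zmod_morphism presalg_pi.
Proof. exact: (raddfB (\pi_(Quotient.quot ideal))). Qed.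

HB.instance Definition _ :=
  GRing.isZmodMorphism.Build A presalg presalg_pi presalg_pi_zmod.

Definition presalg_repr (u : presalg) : A := @repr _ (Quotient.quot ideal) u.

Lemma presalg_reprP x : presalg_repr (presalg_pi x) - x \in ideal.
Proof. by apply/presalg_eq; rewrite {1}/presalg_pi reprK. Qed.

Definition presalg_mul (u v : presalg) : presalg :=
  presalg_pi (presalg_repr u * presalg_repr v).

Lemma presalg_mulE x y :
  presalg_mul (presalg_pi x) (presalg_pi y) = presalg_pi (x * y).
Proof.
rewrite /presalg_mul; apply/presalg_eq.
set x' := presalg_repr _; set y' := presalg_repr _.
have -> : x' * y' - x * y = (x' - x) * y' + x * (y' - y).
  by rewrite mulrBl mulrBr addrA subrK.
by apply: rpredD; [apply: ideal_mulr | apply: ideal_mull]; apply: presalg_reprP.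
Qed.

Fact presalg_mulA : associative presalg_mul.
Proof.
elim/presalg_ind=> x; elim/presalg_ind=> y; elim/presalg_ind=> z.
by rewrite !presalg_mulE mulrA.
Qed.

Fact presalg_mul1 : left_id (presalg_pi 1) presalg_mul.
Proof. by elim/presalg_ind=> x; rewrite presalg_mulE mul1r. Qed.

Fact presalg_mulr1 : right_id (presalg_pi 1) presalg_mul.
Proof. by elim/presalg_ind=> x; rewrite presalg_mulE mulr1. Qed.

Fact presalg_mulDl : left_distributive presalg_mul +%R.
Proof.
elim/presalg_ind=> x; elim/presalg_ind=> y; elim/presalg_ind=> z.
by rewrite -raddfD !presalg_mulE mulrDl raddfD.
Qed.

Fact presalg_mulDr : right_distributive presalg_mul +%R.
Proof.
elim/presalg_ind=> x; elim/presalg_ind=> y; elim/presalg_ind=> z.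
by rewrite -raddfD !presalg_mulE mulrDr raddfD.
Qed.

HB.instance Definition _ := GRing.Zmodule_isPzRing.Build presalg
  presalg_mulA presalg_mul1 presalg_mulr1 presalg_mulDl presalg_mulDr.

Fact presalg_pi_monoid : monoid_morphism presalg_pi.
Proof. by split=> // x y; rewrite -presalg_mulE. Qed.

HB.instance Definition _ :=
  GRing.isMonoidMorphism.Build A presalg presalg_pi presalg_pi_monoid.

Fact presalg_scalar_central a u :
  GRing.comm ((presalg_pi \o scalar : {rmorphism F -> presalg}) a) u.
Proof.
elim/presalg_ind: u => x.
by rewrite /GRing.comm /= -!rmorphM /= scalar_central.
Qed.

HB.instance Definition _ :=
  PzRing_isAlgebra.Build F presalg presalg_scalar_central.

End PresentedAlgebra.

(* The free associative F-algebra on X, as the algebra of the free monoid.    *)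
Section FreeAlgebra.
Variables (F : fieldType) (X : choiceType).

Definition freealg : Type := {malg F[{fmonom X}]}.

HB.instance Definition _ := GRing.Lalgebra.on freealg.

Fact freealg_scalar_central (a : F) (u : freealg) :
  GRing.comm ((@malgC {fmonom X} F : {rmorphism F -> freealg}) a) u.
Proof.
rewrite /GRing.comm /= malgM_def fgmulUg malgM_def fgmulgU.
by apply: eq_bigr => k _; rewrite mulrC mul1m mulm1.
Qed.

HB.instance Definition _ :=
  PzRing_isAlgebra.Build F freealg freealg_scalar_central.

Definition freealg_var (x : X) : freealg := << fmu x >>.

End FreeAlgebra.

Section KLR.
Variables (F : fieldType) (e n : nat).

Local Notation I := 'Z_e.
Local Notation In := (n.-tuple 'Z_e).

(* The entry i_r of i, for 1 <= r <= n. *)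
Definition res (i : In) (r : nat) : I := nth 0 i r.-1.

(* The place permutation of i by (r, r + 1). *)
Definition sact (r : nat) (i : In) : In :=
  [tuple res i (if k.+1 == r then r.+1 else if k.+1 == r.+1 then r else k.+1)
  | k < n].

Definition arrow (i j : I) : bool := j == i + 1.

Definition klr_index : choiceType :=
  (In + {r : nat | 0 < r <= n}%N + {r : nat | 0 < r < n}%N)%type.

Local Notation free := (freealg F klr_index).

(* The generators y_r and psi_r are indexed from 1, as usual; their value     *)
(* outside 1 <= r <= n, resp. 1 <= r < n, is a dummy 0.                       *)
Definition fe (i : In) : free := freealg_var F (inl (inl i) : klr_index).
Definition fy (r : nat) : free :=
  if insub r is Some u then freealg_var F (inl (inr u) : klr_index) else 0.
Definition fpsi (r : nat) : free :=
  if insub r is Some u then freealg_var F (inr u : klr_index) else 0.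

Definition fquad (r : nat) (i : In) : free :=
  if res i r == res i r.+1 then 0
  else if arrow (res i r) (res i r.+1) then fy r.+1 - fy r
  else if arrow (res i r.+1) (res i r) then fy r - fy r.+1
  else 1.

Definition fbraid (r : nat) (i : In) : free :=
  if (res i r.+2 == res i r) && arrow (res i r) (res i r.+1) then 1
  else if (res i r.+2 == res i r) && arrow (res i r.+1) (res i r) then -1
  else 0.

Inductive klr_rel : free -> free -> Prop :=
| klr_ee i j : klr_rel (fe i * fe j) (if i == j then fe i else 0)
| klr_sum : klr_rel (\sum_i fe i) 1
| klr_ye r i of (0 < r <= n)%N : klr_rel (fy r * fe i) (fe i * fy r)
| klr_psie r i of (0 < r < n)%N :
    klr_rel (fpsi r * fe i) (fe (sact r i) * fpsi r)
| klr_yy r s of (0 < r <= n)%N & (0 < s <= n)%N :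
    klr_rel (fy r * fy s) (fy s * fy r)
| klr_psiy r s of (0 < r < n)%N & (0 < s <= n)%N & s != r & s != r.+1 :
    klr_rel (fpsi r * fy s) (fy s * fpsi r)
| klr_psipsi r s of (0 < r < n)%N & (0 < s < n)%N
    & (r.+1 < s)%N || (s.+1 < r)%N :
    klr_rel (fpsi r * fpsi s) (fpsi s * fpsi r)
| klr_psiyS r i of (0 < r < n)%N :
    klr_rel (fpsi r * fy r.+1 * fe i)
            ((fy r * fpsi r + (res i r == res i r.+1)%:R) * fe i)
| klr_ySpsi r i of (0 < r < n)%N :
    klr_rel (fy r.+1 * fpsi r * fe i)
            ((fpsi r * fy r + (res i r == res i r.+1)%:R) * fe i)
| klr_quad r i of (0 < r < n)%N :
    klr_rel (fpsi r ^+ 2 * fe i) (fquad r i * fe i)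
| klr_braid r i of (0 < r)%N & (r.+1 < n)%N :
    klr_rel (fpsi r * fpsi r.+1 * fpsi r * fe i)
            ((fpsi r.+1 * fpsi r * fpsi r.+1 + fbraid r i) * fe i).

Definition klr : pzAlgType F := presalg klr_rel.

Definition he (i : In) : klr := presalg_pi klr_rel (fe i).
Definition hy (r : nat) : klr := presalg_pi klr_rel (fy r).
Definition hpsi (r : nat) : klr := presalg_pi klr_rel (fpsi r).

Variables k1 k2 : I.

Inductive cyc_rel : klr -> klr -> Prop :=
| Cyc_rel i :
    cyc_rel (hy 1 ^+ ((k1 == res i 1) + (k2 == res i 1))%N * he i) 0.

(* The cyclotomic quotient of level 2, for kappa = (k1, k2). *)
Definition cyc : pzAlgType F := presalg cyc_rel.

Definition ce (i : In) : cyc := presalg_pi cyc_rel (he i).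
Definition cy (r : nat) : cyc := presalg_pi cyc_rel (hy r).
Definition cpsi (r : nat) : cyc := presalg_pi cyc_rel (hpsi r).

Section Specht.
Variable m : nat.

Definition res_hook2 : In :=
  [tuple if (k < m)%N then k2 - k%:R else k1 + (k - m)%N%:R | k < n].

Inductive hook2_rel : cyc -> cyc -> Prop :=
| hook2_e : hook2_rel (ce res_hook2) 1
| hook2_y r of (0 < r <= n)%N : hook2_rel (cy r) 0
| hook2_psi r of (0 < r < n)%N & r != m : hook2_rel (cpsi r) 0.

(* The Specht module labelled by ((n - m), (1^m)), for 0 <= m <= n. *)
Definition specht_hook2 : lmodType cyc := presmod hook2_rel.
Definition z_hook2 : specht_hook2 := presmod_gen hook2_rel.

(* psi_{b - 1} psi_{b - 2} ... psi_a *)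
Definition psi_down (b a : nat) : cyc :=
  \prod_(r <- rev (index_iota a b)) cpsi r.

(* v(a_1, ..., a_m), for a = [:: a_1; ...; a_m] *)
Definition v_hook2 (a : seq nat) : specht_hook2 :=
  (\prod_(1 <= j < m.+1) psi_down (nth 0 a j.-1)%N j) *: z_hook2.

Definition res_hook1 : In :=
  [tuple if (k <= m)%N then k1 - k%:R else k1 + (k - m)%N%:R | k < n].

Inductive hook1_rel : cyc -> cyc -> Prop :=
| hook1_e : hook1_rel (ce res_hook1) 1
| hook1_y r of (0 < r <= n)%N : hook1_rel (cy r) 0
| hook1_psi r of (0 < r < n)%N & r != m.+1 : hook1_rel (cpsi r) 0
| hook1_garnir of (m.+2 <= n)%N : hook1_rel (\prod_(1 <= r < m.+2) cpsi r) 0.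

(* The Specht module labelled by ((n - m, 1^m), empty), for 0 <= m < n. *)
Definition specht_hook1 : lmodType cyc := presmod hook1_rel.
Definition z_hook1 : specht_hook1 := presmod_gen hook1_rel.

End Specht.
End KLR.

(* Main.v *)
(* A standard tableau of shape ((n-m), (1^m)) is a word t of length n in the  *)
(* letters leg (m times) and arm. As k2 = k1 - 1, a leg node and an arm node  *)
(* competing for position p have the same residue exactly when e divides p.   *)
(* Hence psi_r and y_r act on the basis elements v(t) by signed moves that    *)
(* only involve letters in positions r-1, ..., r+2, and the KLR relations can *)
(* be checked on windows of at most five letters. This gives a faithful model *)
(* of the Specht module, because the v(t) span it by straightening.           *)
(*   As e does not divide n, two tableaux are always separated by the residue *)
(* idempotents e(i) and the idempotents -psi_p y_p, -y_p psi_p with e | p, so *)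
(* every submodule is spanned by elements v(t). All moves in positions r > 1  *)
(* can be undone inside the algebra, whereas a first letter arm never becomes *)
(* leg. Hence im(chi_m) is spanned by the v(t) with first letter arm, the     *)
(* quotient by those with first letter leg, and both are irreducible.         *)

Require Import Defs.
From HB Require Import structures.
From mathcomp Require Import all_boot all_order all_algebra.
From mathcomp Require Import finmap boolp monalg zify ring.

Set Implicit Arguments.
Unset Strict Implicit.
Unset Printing Implicit Defensive.

Import GRing.Theory.

Local Open Scope ring_scope.

(** The Specht module is compared with an explicit model: functions on infinite words in the letters
    leg and arm, on which the generators act by [psi_op], [dot_op] and [proj]. These operators
    satisfy the relations of the algebra ([klr_rel_act], [cyc_rel_act]), and the indicator of the
    word with its m legs in front satisfies the relations of z ([hook2_rel_act]). This gives a map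
    [phi] from the Specht module to the model. It sends [stdvec t] to the indicator of t
    ([phi_stdvec]), while straightening ([spanP], [filt_top]) shows that the vectors [stdvec t]
    span. Hence the values of [phi x] are the coordinates of x ([reconstruct]).

    Since e does not divide n, two tableaux with the same residue sequence first differ at a
    position p < n with e | p, and there one reads leg, arm and the other arm, leg. So idempotents
    of the algebra isolate every tableau that occurs in x ([separate], [gen_stdvec]). An adjacent
    exchange that avoids the first letter can be made in both directions ([psi_ft], [undoP]), so
    standard vectors with the same first letter generate one another ([gen_swap], [gen_head]). The
    functions supported on words with first letter arm are stable ([armfirst_act]), and the image of
    chi is generated by such a vector. Therefore each nonzero element of the image generates it
    ([gen_image_irr]), and each element outside the image generates z ([gen_quotient_irr]). *)

Local Notation stream := (nat -> bool).

(** * Algebras acting on spaces of functions *)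

Section Actions.
Variables (F : fieldType) (T : Type).
Local Notation V := (T -> F).
Implicit Types (f g : V) (a : F).

Definition comb a f g : V := fun t => a * f t + g t.

Definition lin (O : V -> V) := forall a f g, O (comb a f g) = comb a (O f) (O g).

(** Left actions on all functions T -> F, with no condition on supports. Linearity over F is
    pointwise. *)
Record action (A : pzAlgType F) := Action {
  act :> A -> V -> V;
  act_lin x : lin (act x);
  actD x y f t : act (x + y) f t = act x f t + act y f t;
  act1 f : act 1 f = f;
  actM x y f : act (x * y) f = act x (act y f);
  act_scalar a f t : act (Defs.scalar a) f t = a * f t }.

Lemma lin0 (O : V -> V) t : lin O -> O (fun=> 0) t = 0.
Proof.
have h : comb (-1) (fun=> 0) (fun=> 0) = (fun=> 0) :> V.
  by apply/funext=> s; rewrite /comb mulr0 addr0.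
by move=> O_lin; rewrite -{1}h O_lin /comb mulN1r addNr.
Qed.

Section ActionTheory.
Variables (A : pzAlgType F) (rho : action A).

Lemma act0 f t : rho 0 f t = 0.
Proof. by have /eqP := actD rho 0 0 f t;
  rewrite addr0 -subr_eq0 opprD addNKr oppr_eq0 => /eqP. Qed.

Lemma actN x f t : rho (- x) f t = - rho x f t.
Proof. by apply/eqP; rewrite -addr_eq0 -actD addNr act0. Qed.

Lemma actB x y f t : rho (x - y) f t = rho x f t - rho y f t.
Proof. by rewrite actD actN. Qed.

Lemma act_sum (J : Type) (s : seq J) (P : pred J) (G : J -> A) f t :
  rho (\sum_(j <- s | P j) G j) f t = \sum_(j <- s | P j) rho (G j) f t.
Proof. by apply: (big_morph (fun x => rho x f t)) => [x y|]; rewrite ?actD ?act0. Qed.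

Lemma act_zero x : rho x (fun=> 0) = fun=> 0.
Proof. by apply/funext=> t; rewrite lin0 //; apply: act_lin. Qed.

Variable (rel : A -> A -> Prop).
Hypothesis rel_act : forall x y, rel x y -> rho x = rho y.

Lemma ideal_act x f t : x \in ideal rel -> rho x f t = 0.
Proof.
move=> /asboolP h; elim: h f t => [a b ab|| u v _ IHu _ IHv |a u b _ IHu] f t.
- by rewrite actB (rel_act ab) subrr.
- exact: act0.
- by rewrite actD IHu IHv addr0.
- rewrite !actM (_ : rho u (rho b f) = fun=> 0) ?act_zero //.
  by apply/funext=> s; rewrite IHu.
Qed.

Definition presalg_act (u : presalg rel) : V -> V := rho (presalg_repr u).

Lemma presalg_actE x : presalg_act (presalg_pi rel x) = rho x.
Proof.
apply/funext=> f; apply/funext=> t; apply/eqP; rewrite -subr_eq0 -actB.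
by rewrite ideal_act // presalg_reprP.
Qed.

Definition presalg_action : action (presalg rel).
Proof.
apply: (@Action _ presalg_act).
- by move=> u; apply: act_lin.
- elim/presalg_ind=> x; elim/presalg_ind=> y f t.
  by rewrite -rmorphD !presalg_actE actD.
- by move=> f; rewrite -(rmorph1 (presalg_pi rel)) presalg_actE act1.
- elim/presalg_ind=> x; elim/presalg_ind=> y f.
  by rewrite -rmorphM !presalg_actE actM.
- by move=> a f t; rewrite presalg_actE act_scalar.
Defined.

End ActionTheory.

Section FreeAction.
Variables (X : choiceType) (op : X -> V -> V).
Hypothesis op_lin : forall x, lin (op x).

Definition word_act (k : seq X) f : V := foldr op f k.

Lemma word_act_lin k : lin (word_act k).
Proof. by elim: k => [|x k IH] a f g //=; rewrite IH op_lin. Qed.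

Definition free_act (u : freealg F X) f : V :=
  fun t => mmap idfun (fun k : {fmonom X} => word_act k f t) u.

Lemma free_actU c k f t : free_act << c *g k >> f t = c * word_act k f t.
Proof. by rewrite /free_act mmapU. Qed.

Lemma free_actD u v f t : free_act (u + v) f t = free_act u f t + free_act v f t.
Proof. exact: mmapD. Qed.

Lemma free_act_lin u : lin (free_act u).
Proof.
move=> a f g; apply/funext=> t; rewrite /comb /free_act /mmap mulr_sumr -big_split.
by apply: eq_bigr => k _ /=; rewrite word_act_lin /comb mulrDr mulrCA.
Qed.

Lemma freealg_ind (P : freealg F X -> Prop) :
  P 0 -> (forall u v, P u -> P v -> P (u + v)) -> (forall c k, P << c *g k >>) ->
  forall u, P u.
Proof. by move=> P0 PD PU u; rewrite [u]monalgE; apply: big_ind. Qed.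

Lemma free_act0 f t : free_act 0 f t = 0.
Proof. exact: mmap0. Qed.

Lemma free_act_zero u : free_act u (fun=> 0) = fun=> 0.
Proof. by apply/funext=> t; rewrite lin0 //; apply: free_act_lin. Qed.

Lemma free_actM u v f : free_act (u * v) f = free_act u (free_act v f).
Proof.
elim/freealg_ind: u => [|u1 u2 IH1 IH2|c k].
- by rewrite mul0r; apply/funext=> t; rewrite !free_act0.
- rewrite mulrDl; apply/funext=> t; rewrite (free_actD (_ * _)) (free_actD u1).
  by congr (_ + _); [exact: (congr1 (@^~ t) IH1)|exact: (congr1 (@^~ t) IH2)].
elim/freealg_ind: v => [|v1 v2 IH1 IH2|d l].
- rewrite mulr0 [X in _ = free_act _ X](_ : _ = fun=> 0) ?free_act_zero.
    by apply/funext=> t; rewrite free_act0.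
  by apply/funext=> t; rewrite free_act0.
- rewrite mulrDr [X in _ = free_act _ X](_ : _ = comb 1 (free_act v1 f) (free_act v2 f)).
    rewrite free_act_lin; apply/funext=> t.
    rewrite (free_actD (_ * v1)) /comb mul1r.
    by congr (_ + _); [exact: (congr1 (@^~ t) IH1)|exact: (congr1 (@^~ t) IH2)].
  by apply/funext=> t; rewrite free_actD /comb mul1r.
apply/funext=> t; have -> : << c *g k >> * << d *g l >> = << c * d *g mmul k l >> :>
  freealg F X.
  by rewrite malgM_def fgmulUU.
have -> : free_act << d *g l >> f = comb d (word_act l f) (fun=> 0).
  by apply/funext=> s; rewrite free_actU /comb addr0.
rewrite !free_actU word_act_lin fmM /word_act foldr_cat /comb.
have -> : foldr op (fun=> 0) k = fun=> 0.
  by apply/funext=> r; rewrite -[foldr _ _ _]/(word_act k _) lin0 //; apply: word_act_lin.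
by rewrite addr0 mulrA.
Qed.

Definition free_action : action (freealg F X).
Proof.
apply: (@Action _ free_act free_act_lin free_actD _ free_actM).
- by move=> f; apply/funext=> t; rewrite free_actU mul1r fm1.
- by move=> a f t; rewrite free_actU fm1.
Defined.

Lemma free_act_var x f : free_act (freealg_var F x) f = op x f.
Proof. by apply/funext=> t; rewrite free_actU mul1r fmU. Qed.

End FreeAction.
End Actions.

(** * Local operators on words *)

Section Streams.
Definition scons (T : Type) (x : T) (b : nat -> T) : nat -> T :=
  fun p => if p is q.+1 then b q else x.
Definition stl (T : Type) (b : nat -> T) : nat -> T := fun p => b p.+1.

Lemma stl_scons T (x : T) b : stl (scons x b) = b.
Proof. by []. Qed.

Lemma stream_ind1 (P : stream -> Prop) :
  (forall x b, P (scons x b)) -> forall b, P b.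
Proof.
move=> h b; rewrite (_ : b = scons (b 0%N) (stl b)) //.
by apply/funext=> -[].
Qed.

Lemma stream_ind2 (P : stream -> Prop) :
  (forall x y b, P (scons x (scons y b))) -> forall b, P b.
Proof. by move=> h; elim/stream_ind1=> x; elim/stream_ind1. Qed.

Lemma stream_ind3 (P : stream -> Prop) :
  (forall x y z b, P (scons x (scons y (scons z b)))) -> forall b, P b.
Proof. by move=> h; elim/stream_ind2=> x y; elim/stream_ind1. Qed.

Lemma stream_ind4 (P : stream -> Prop) :
  (forall x y z u b, P (scons x (scons y (scons z (scons u b))))) -> forall b, P b.
Proof. by move=> h; elim/stream_ind3=> x y z; elim/stream_ind1. Qed.

Lemma stream_ind5 (P : stream -> Prop) :
  (forall x y z u v b, P (scons x (scons y (scons z (scons u (scons v b)))))) ->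
  forall b, P b.
Proof. by move=> h; elim/stream_ind4=> x y z u; elim/stream_ind1. Qed.
End Streams.

Section LocalOperators.
Variable F : fieldType.
Local Notation V := (stream -> F).
Local Notation oper := (V -> V).
Implicit Types (f : V) (O P Q : oper) (b : stream).

(** Words are infinite so that an operator can be placed at any offset without boundary conditions.
    A finite word is later padded with arms. *)
Definition shift O : oper := fun f b => O (fun w => f (scons (b 0%N) w)) (stl b).
Definition off k O : oper := iter k shift O.

Definition ozero : oper := fun f b => 0.
Definition oadd O P : oper := fun f b => O f b + P f b.
Definition oopp O : oper := fun f b => - O f b.
Definition ocomp O P : oper := fun f => O (P f).

(* In a word, true stands for leg and false for arm. A combination of words   *)
(* is given by its coefficient function, so that an operator mapping the word *)
(* u to c w is written (O f) w = c * f u; for instance, up moves a leg behind *)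
(* the next arm.                                                              *)
Definition up : oper := fun f b =>
  match b 0%N, b 1%N with
  | false, true => f (scons true (scons false (stl (stl b))))
  | _, _ => 0
  end.

Definition down : oper := fun f b =>
  match b 0%N, b 1%N with
  | true, false => f (scons false (scons true (stl (stl b))))
  | _, _ => 0
  end.

Definition cross : oper := oadd up down.

(** The further terms of psi_r next to a multiple of e: they send arm leg leg to leg leg arm, and
    arm arm leg to minus leg arm arm. Once [up] has coefficient 1, the signs are forced by the
    corrections in the braid relation. *)
Definition turn : oper := fun f b =>
  match b 0%N, b 1%N, b 2 with
  | true, true, false =>
    f (scons false (scons true (scons true (stl (stl (stl b))))))
  | true, false, false =>
    - f (scons false (scons false (scons true (stl (stl (stl b))))))
  | _, _, _ => 0
  end.

Definition psim : oper := oadd up turn.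
Definition psi1 : oper := oadd (shift up) turn.

Definition diag (d : stream -> F) : oper := fun f b => d b * f b.

Definition oeq O P := forall f b, O f b = P f b.

Lemma oeqP O P : oeq O P -> O = P.
Proof. by move=> h; apply/funext=> f; apply/funext=> b; apply: h. Qed.

Lemma off_comp k O P : off k (ocomp O P) = ocomp (off k O) (off k P).
Proof. by elim: k => //= k ->. Qed.

Lemma off_add k O P : off k (oadd O P) = oadd (off k O) (off k P).
Proof. by elim: k => //= k ->. Qed.

Lemma off_opp k O : off k (oopp O) = oopp (off k O).
Proof. by elim: k => //= k ->. Qed.

Lemma off_zero k : off k ozero = ozero.
Proof. by elim: k => //= k ->. Qed.

Lemma offS k O : off k.+1 O = off k (shift O).
Proof. by rewrite /off iterSr. Qed.

Lemma off_off j k O : off (j + k) O = off j (off k O).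
Proof. by rewrite /off iterD. Qed.

Lemma linN O f b : lin O -> O (fun w => - f w) b = - O f b.
Proof.
move=> O_lin; have -> : (fun w => - f w) = comb (-1) f (fun=> 0).
  by apply/funext=> w; rewrite /comb mulN1r addr0.
by rewrite O_lin /comb lin0 // mulN1r addr0.
Qed.

Lemma linD O f g b : lin O -> O (fun w => f w + g w) b = O f b + O g b.
Proof.
move=> O_lin; have -> : (fun w => f w + g w) = comb 1 f g.
  by apply/funext=> w; rewrite /comb mul1r.
by rewrite O_lin /comb mul1r.
Qed.

Lemma lin_add O P : lin O -> lin P -> lin (oadd O P).
Proof.
move=> hO hP a f g; apply/funext=> b; rewrite /oadd hO hP /comb; ring.
Qed.

Lemma lin_opp O : lin O -> lin (oopp O).
Proof. move=> hO a f g; apply/funext=> b; rewrite /oopp hO /comb; ring. Qed.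

Lemma lin_zero : lin ozero.
Proof. by move=> a f g; apply/funext=> b; rewrite /ozero /comb mulr0 addr0. Qed.

Lemma lin_shift O : lin O -> lin (shift O).
Proof.
move=> hO a f g; apply/funext=> b; rewrite /shift.
by rewrite -[fun w => comb a f g _]/(comb a _ _) hO.
Qed.

Lemma lin_off k O : lin O -> lin (off k O).
Proof. by move=> hO; elim: k => //= k; apply: lin_shift. Qed.

Lemma lin_up : lin up.
Proof.
by move=> a f g; apply/funext=> b; rewrite /up /comb; case: (b 0%N) (b 1%N) => -[];
  rewrite ?mulr0 ?addr0.
Qed.

Lemma lin_down : lin down.
Proof.
by move=> a f g; apply/funext=> b; rewrite /down /comb; case: (b 0%N) (b 1%N) => -[];
  rewrite ?mulr0 ?addr0.
Qed.

Lemma lin_turn : lin turn.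
Proof.
move=> a f g; apply/funext=> b; rewrite /turn /comb.
by case: (b 0%N) (b 1%N) (b 2) => -[] []; rewrite ?mulr0 ?addr0 // mulrN opprD.
Qed.

Lemma lin_cross : lin cross.
Proof. exact: lin_add lin_up lin_down. Qed.
Lemma lin_psim : lin psim.
Proof. exact: lin_add lin_up lin_turn. Qed.
Lemma lin_psi1 : lin psi1.
Proof. exact: lin_add (lin_shift lin_up) lin_turn. Qed.

(* O only involves the first d letters: it commutes with all operators that   *)
(* act on the later ones.                                                     *)
Definition width d O := forall P f b, lin P -> O (off d P f) b = off d P (O f) b.

Lemma width_up : width 2 up.
Proof. by move=> P f + hP; elim/stream_ind2=> -[] [] w; rewrite /= /up /shift /= ?lin0. Qed.

Lemma width_down : width 2 down.
Proof. by move=> P f + hP; elim/stream_ind2=> -[] [] w;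
  rewrite /= /down /shift /= ?lin0. Qed.

Lemma width_turn : width 3 turn.
Proof.
by move=> P f + hP; elim/stream_ind3=> -[] [] [] w; rewrite /= /turn /shift /= ?lin0 ?linN.
Qed.

Lemma width_add d O P : width d O -> width d P -> width d (oadd O P).
Proof.
move=> hO hP Q f b hQ; rewrite /oadd hO // hP // -linD //; exact: lin_off.
Qed.

Lemma width_shift d O : width d O -> width d.+1 (shift O).
Proof. by move=> hO P f b hP; apply: (hO P (fun w => f (scons (b 0%N) w)) (stl b) hP). Qed.

Lemma widthS d O : width d O -> width d.+1 O.
Proof. by move=> hO P f b hP; rewrite offS hO //; apply: lin_shift. Qed.

Lemma width_cross : width 2 cross.
Proof. exact: width_add width_up width_down. Qed.
Lemma width_psim : width 3 psim.
Proof. exact: width_add (widthS width_up) width_turn. Qed.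
Lemma width_psi1 : width 3 psi1.
Proof. exact: width_add (width_shift width_up) width_turn. Qed.

Lemma off_commute d O P k l : width d O -> lin P -> (k + d <= l)%N ->
  ocomp (off k O) (off l P) = ocomp (off l P) (off k O).
Proof.
move=> hO hP le; rewrite (_ : l = k + (d + (l - k - d)))%N; last by lia.
rewrite (off_off k) -!off_comp; congr (off k _).
rewrite off_off; apply: oeqP => f b; rewrite /ocomp hO //; exact: lin_off.
Qed.

(** Both sides of such an identity read at most five letters, so 32 cases suffice. *)
Ltac window := apply: oeqP => f;
  (elim/stream_ind5 || idtac) => -[] [] [] [] [] w;
  rewrite /ocomp /oadd /oopp /ozero /psim /psi1 /cross /diag /oadd /turn /down /up /shift
    /=;
  rewrite ?opprK ?oppr0 ?addr0 ?add0r ?subr0 ?mul0r ?mul1r ?mulN1r ?opprK //; try ring.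

Definition neq01 b : F := (b 0%N != b 1%N)%:R.
Definition isw (x y z : bool) b : F := [&& b 0%N == x, b 1%N == y & b 2 == z]%:R.

Lemma up_down : ocomp up down = oadd (oopp (ocomp down up)) (diag neq01).
Proof. rewrite /neq01; window. Qed.
Lemma down_up : ocomp down up = oadd (oopp (ocomp up down)) (diag neq01).
Proof. rewrite /neq01; window. Qed.
Lemma down_psi1 : ocomp down psi1 = ozero.
Proof. window. Qed.
Lemma psi1_down : ocomp psi1 down = ozero.
Proof. window. Qed.
Lemma psim_sdown : ocomp psim (shift down) = ozero.
Proof. window. Qed.
Lemma sdown_psim : ocomp (shift down) psim = ozero.
Proof. window. Qed.
Lemma up_up : ocomp up up = ozero.
Proof. window. Qed.
Lemma cross_cross : ocomp cross cross = diag neq01.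
Proof. rewrite /neq01; window. Qed.
Lemma psim_spsi1 : ocomp psim (shift psi1) = ocomp (shift psi1) psim.
Proof. window. Qed.

(** The corrections in the braid relation for psi_r and psi_{r+1}: [br0] when e divides r, [brm]
    when e divides r + 1. *)
Definition br0 : oper := oadd (oopp (diag (isw true true false)))
  (diag (isw false false true)).
Definition brm : oper := oadd (oopp (diag (isw true false false)))
  (diag (isw false true true)).

Lemma braid_0 : ocomp up (ocomp psi1 up) = oadd (ocomp psi1 (ocomp up psi1)) br0.
Proof. rewrite /br0 /isw; window. Qed.
Lemma braid_m : ocomp psim (ocomp (shift up) psim) =
  oadd (ocomp (shift up) (ocomp psim (shift up))) brm.
Proof. rewrite /brm /isw; window. Qed.
Lemma braid_sm : ocomp cross (ocomp (shift psim) cross) = ocomp (shift psim)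
  (ocomp cross (shift psim)).
Proof. window. Qed.
Lemma braid_um : ocomp up (ocomp (shift psim) up) = ocomp (shift psim)
  (ocomp up (shift psim)).
Proof. window. Qed.
Lemma braid_1m : ocomp psi1 (ocomp (shift (shift psim)) psi1) =
  ocomp (shift (shift psim)) (ocomp psi1 (shift (shift psim))).
Proof. window. Qed.
Lemma braid_1s : ocomp psi1 (ocomp (shift (shift cross)) psi1) =
  ocomp (shift (shift cross)) (ocomp psi1 (shift (shift cross))).
Proof. window. Qed.
Lemma braid_us : ocomp up (ocomp (shift cross) up) = ocomp (shift cross)
  (ocomp up (shift cross)).
Proof. window. Qed.
Lemma braid_ss : ocomp cross (ocomp (shift cross) cross) = ocomp (shift cross)
  (ocomp cross (shift cross)).
Proof. window. Qed.

End LocalOperators.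

(** * The operators of the generators and their effect on residues *)

Section Model.
Variables (F : fieldType) (e : nat).
Hypothesis e_ge3 : (3 <= e)%N.
Local Notation V := (stream -> F).
Local Notation oper := (V -> V).
Local Notation I := 'Z_e.

(* The action of psi_r and y_r. The cases r = -1, 0, 1 modulo e are those in  *)
(* which distinct letters r, r + 1 have equal or adjacent residues.           *)
Definition psi_op (r : nat) : oper :=
  if (r == 1)%N then @up F
  else if r%:R == 0 :> I then off r.-1 (@up F)
  else if r%:R == 1 :> I then off r.-2 (@psi1 F)
  else if r%:R == -1 :> I then off r.-1 (@psim F)
  else off r.-1 (@cross F).

Definition dot_op (r : nat) : oper :=
  if (r <= 1)%N then @ozero F
  else if r%:R == 0 :> I then oopp (off r.-1 (@down F))
  else if r%:R == 1 :> I then off r.-2 (@down F)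
  else @ozero F.

Lemma two_neq0 : (1 + 1 : I) != 0.
Proof.
rewrite -(natrD _ 1 1); apply/eqP => /(congr1 (@nat_of_ord _)).
by rewrite val_Zp_nat ?modn_small //; lia.
Qed.

Lemma one_neqN1 : (1 : I) != -1.
Proof. by rewrite -subr_eq0 opprK two_neq0. Qed.

Lemma oneI_neq0 : (1 : I) != 0. Proof. exact: oner_neq0. Qed.

Lemma pred_one k : k.+1%:R = 1 :> I -> k%:R = 0 :> I.
Proof. by move=> /eqP; rewrite -natr1 -subr_eq0 addrK => /eqP. Qed.

(** Yields psi_r, y_r and y_{r+1} at once, with k the offset of the window, so that truncated
    predecessors of r disappear. The case r = 1 is separate because the window of [psi1] would begin
    before the first letter. *)
Inductive psi_spec : nat -> oper -> oper -> oper -> Type :=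
| PsiFirst : psi_spec 1 (off 0 (@up F)) (@ozero F) (@ozero F)
| PsiZero k of (0 < k)%N & k.+1%:R = 0 :> I :
    psi_spec k.+1 (off k (@up F)) (oopp (off k (@down F))) (off k (@down F))
| PsiOne k of (0 < k)%N & k.+1%:R = 0 :> I :
    psi_spec k.+2 (off k (@psi1 F)) (off k (@down F)) (@ozero F)
| PsiMinus k of (0 < k)%N & k.+2%:R = 0 :> I :
    psi_spec k.+1 (off k (@psim F)) (@ozero F) (oopp (off k (shift (@down F))))
| PsiGen k of (0 < k)%N & k.+1%:R != 0 :> I & k.+1%:R != 1 :> I & k.+1%:R != -1 :> I :
    psi_spec k.+1 (off k (@cross F)) (@ozero F) (@ozero F).

Lemma psiP r : (0 < r)%N -> psi_spec r (psi_op r) (dot_op r) (dot_op r.+1).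
Proof.
case: r => // -[|k] _.
  rewrite (_ : dot_op 2 = @ozero F); first exact: PsiFirst.
  rewrite /dot_op /= (natrD _ 1 1) (negPf two_neq0).
  by rewrite -subr_eq0 addrK (negPf oneI_neq0).
rewrite /psi_op /dot_op /= -[k.+3%:R]natr1; case: eqP => [c0|/eqP c0].
  by rewrite c0 add0r (negPf oneI_neq0) eqxx; apply: PsiZero.
have -> : (k.+2%:R + 1 == 1 :> I) = false.
  by rewrite -subr_eq0 addrK (negPf c0).
case: eqP => [c1|/eqP c1].
  rewrite c1 (negPf two_neq0); have c2 := pred_one c1; case: k c0 c1 c2 => [|k] c0 c1 c2.
    by case/eqP: oneI_neq0.
  exact: PsiOne.
rewrite addr_eq0; case: eqP => [cm|/eqP cm].
  rewrite -[shift (shift _)]/(off k.+2 _) offS; apply: PsiMinus => //.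
  by rewrite -natr1 cm addNr.
exact: PsiGen.
Qed.

(* Residues: A is the residue of a leg node in the first position, A + P that *)
(* of an arm node.                                                            *)
Fixpoint rsd (A P : I) (b : stream) (q : nat) : I :=
  if q is q'.+1 then rsd (A - (b 0%N)%:R) (P + 1) (stl b) q'
  else A + (if b 0%N then 0 else P).

Definition swp (k q : nat) : nat :=
  if q == k then k.+1 else if q == k.+1 then k else q.

(** O moves words only to words whose residue sequence is permuted by s. With h the test for one
    residue sequence, this gives the relations between the generators and e(i). *)
Definition compat (O : oper) (s : nat -> nat) (A P : I) :=
  forall (h : (nat -> I) -> F) f b,
    O (fun w => h (rsd A P w) * f w) b = h (rsd A P b \o s) * O f b.

Lemma compat_add O O' s A P :
  compat O s A P -> compat O' s A P -> compat (oadd O O') s A P.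
Proof. by move=> h1 h2 h f b; rewrite /oadd h1 h2 mulrDr. Qed.

Lemma compat_opp O s A P : compat O s A P -> compat (oopp O) s A P.
Proof. by move=> h1 h f b; rewrite /oopp h1 mulrN. Qed.

Lemma compat_zero s A P : compat (@ozero F) s A P.
Proof. by move=> h f b; rewrite /ozero mulr0. Qed.

Lemma rsdS A P x b : rsd A P (scons x b) = scons (A + (if x then 0 else P))
  (rsd (A - x%:R) (P + 1) b).
Proof. by apply/funext => -[]. Qed.

Definition sshift (s : nat -> nat) (q : nat) : nat :=
  if q is q'.+1 then (s q').+1 else 0.

Lemma compat_shift O s A P : (forall B, compat O s B (P + 1)) ->
  compat (shift O) (sshift s) A P.
Proof.
move=> hO h f; elim/stream_ind1=> x b; rewrite /shift stl_scons /=.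
under [X in O X _]eq_fun => w do rewrite rsdS.
rewrite (hO _ (fun r => h (scons (A + (if x then 0 else P)) r))).
congr (h _ * _); rewrite rsdS.
by apply/funext => -[].
Qed.

Lemma sshift_swp k : sshift (swp k) = swp k.+1.
Proof. by apply/funext => -[|q] //=; rewrite /swp !eqSS; case: ifP => //; case: ifP. Qed.

Lemma sshift_id : sshift id = id.
Proof. by apply/funext => -[]. Qed.

Lemma compat_off_swp k j O A P : (forall B, compat O (swp j) B (P + k%:R)) ->
  compat (off k O) (swp (k + j)) A P.
Proof.
elim: k A P => [|k IH] A P hO; first by move: (hO A); rewrite addr0.
rewrite /= -sshift_swp; apply: compat_shift => B; apply: IH => C.
by rewrite -addrA nat1r.
Qed.

Lemma compat_off_id k O A P : (forall B, compat O id B (P + k%:R)) ->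
  compat (off k O) id A P.
Proof.
elim: k A P => [|k IH] A P hO; first by move: (hO A); rewrite addr0.
rewrite /= -sshift_id; apply: compat_shift => B; apply: IH => C.
by rewrite -addrA nat1r.
Qed.

Ltac rsdtac := move=> h f; elim/stream_ind3 => -[] [] [] w;
  rewrite ?oppr0 ?mulr0 ?mulrN //; (congr (_ * _) || congr (- (_ * _))); f_equal;
  apply/funext => -[|[|[|q]]]; rewrite /= ?stl_scons; try ring;
  congr (rsd _ _ _ _); ring.

Lemma compat_up A P : compat (@up F) (swp 0) A P.
Proof. rewrite /up; rsdtac. Qed.
Lemma compat_down A P : compat (@down F) (swp 0) A P.
Proof. rewrite /down; rsdtac. Qed.
(** For P = 0 a leg and an arm in this place have the same residue, so exchanging the two letters
    preserves the residue sequence. This is why y_r can act by [down] although it commutes with all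
    e(i). *)
Lemma compat_down0 A : compat (@down F) id A 0.
Proof. rewrite /down; rsdtac. Qed.
Lemma compat_turn0 A : compat (@turn F) (swp 1) A 0.
Proof. rewrite /turn; rsdtac. Qed.
Lemma compat_turnm A : compat (@turn F) (swp 0) A (-1).
Proof. rewrite /turn; rsdtac. Qed.

Lemma compat_psi r A : (0 < r)%N -> compat (psi_op r) (swp r.-1) A 1.
Proof.
case/psiP => [|k _ hc|k _ hc|k _ hc|k _ _ _ _] /=.
- exact: compat_up.
- by move: (@compat_off_swp k 0); rewrite addn0; apply=> B; apply: compat_up.
- move: (@compat_off_swp k 1); rewrite addn1; apply=> B; rewrite nat1r hc.
  apply: compat_add; last exact: compat_turn0.
  by rewrite -sshift_swp; apply: compat_shift => C; apply: compat_up.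
- move: (@compat_off_swp k 0); rewrite addn0; apply=> B; rewrite nat1r.
  have -> : k.+1%:R = -1 :> I by apply/eqP; rewrite -addr_eq0 natr1 hc.
  by apply: compat_add; [apply: compat_up | apply: compat_turnm].
- move: (@compat_off_swp k 0); rewrite addn0; apply=> B.
  by apply: compat_add; [apply: compat_up | apply: compat_down].
Qed.

Lemma compat_dot r A : (0 < r)%N -> compat (dot_op r) id A 1.
Proof.
case/psiP => [|k _ hc|k _ hc|k _ hc|k _ _ _ _] /=; try exact: compat_zero.
- by apply/compat_opp/compat_off_id => B; rewrite nat1r hc; apply: compat_down0.
- by apply/compat_off_id => B; rewrite nat1r hc; apply: compat_down0.
Qed.

End Model.

(** * The KLR relations for words *)

Ltac widthtac :=
  match goal with
  | |- width _ (@up _) => apply: width_up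
  | |- width _ (@down _) => apply: width_down
  | |- width _ (@cross _) => apply: width_cross
  | |- width _ (@psim _) => apply: width_psim
  | |- width _ (@psi1 _) => apply: width_psi1
  end.

Ltac lintac :=
  match goal with
  | |- lin (@up _) => apply: lin_up
  | |- lin (@down _) => apply: lin_down
  | |- lin (@cross _) => apply: lin_cross
  | |- lin (@psim _) => apply: lin_psim
  | |- lin (@psi1 _) => apply: lin_psi1
  end.

Ltac commute := eapply off_commute; [widthtac | lintac | lia].

Section Relations.
Variables (F : fieldType) (e : nat).
Hypothesis e_ge3 : (3 <= e)%N.
Local Notation V := (stream -> F).
Local Notation oper := (V -> V).
Local Notation I := 'Z_e.
Local Notation psi := (@psi_op F e).
Local Notation dot := (@dot_op F e).
Local Notation anchor a := (a%:R = 0 :> I).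

(** The distance between multiples of e decides which windows can overlap; e >= 3 gives a gap of at
    least three. *)
Lemma anchor_far a b : anchor a -> anchor b -> (a < b)%N -> (a + 3 <= b)%N.
Proof.
move=> ha hb ab; have [E|[E|//]] : b = a.+1 \/ b = a.+2 \/ (a + 3 <= b)%N by lia.
- by move/eqP: hb; rewrite E -natr1 ha add0r (negPf (oneI_neq0 e)).
- by move/eqP: hb; rewrite E -natr1 -natr1 ha add0r (negPf (two_neq0 e_ge3)).
Qed.

Lemma anchor_ge3 a : anchor a -> (0 < a)%N -> (3 <= a)%N.
Proof. by move=> /(anchor_far (mulr0n 1)). Qed.

Lemma anchor_gen a k : anchor a -> k%:R != 0 :> I -> k%:R != 1 :> I -> k%:R != -1 :> I ->
  [/\ k <> a, k <> a.+1 & k.+1 <> a].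
Proof.
move=> ha k0 k1 km; split=> E; move: k0 k1 km; rewrite -?E in ha *.
- by rewrite ha eqxx.
- by rewrite E -natr1 ha add0r eqxx.
- by rewrite -addr_eq0 natr1 ha eqxx.
Qed.

Lemma lin_psi r : lin (psi r).
Proof.
case: (posnP r) => [->|/(psiP F e_ge3)[|k _ _|k _ _|k _ _|k _ _ _ _]]; try apply: lin_off.
all: rewrite ?/psi_op /= ?eqxx;
  by [apply: lin_up | apply: lin_psi1 | apply: lin_psim | apply: lin_cross].
Qed.

Lemma lin_dot r : lin (dot r).
Proof.
rewrite /dot_op; do ?case: ifP => _; try exact: lin_zero.
- exact/lin_opp/lin_off/lin_down.
- exact/lin_off/lin_down.
Qed.

Inductive dot_spec : nat -> oper -> Type :=
| DotZero r : dot_spec r (@ozero F)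
| DotNeg k of (0 < k)%N & anchor k.+1 : dot_spec k.+1 (oopp (off k (@down F)))
| DotPos k of (0 < k)%N & anchor k.+1 : dot_spec k.+2 (off k (@down F)).

Lemma dotP r : (0 < r)%N -> dot_spec r (dot r).
Proof. by case/(psiP F e_ge3) => *; constructor. Qed.

Lemma ocomp0 O : ocomp (@ozero F) O = @ozero F. Proof. by []. Qed.
Lemma ocompN O P : ocomp (oopp O) P = oopp (ocomp O P) :> oper. Proof. by []. Qed.
Lemma ocompr0 O : lin O -> ocomp O (@ozero F) = @ozero F.
Proof. by move=> hO; apply: oeqP => f b; rewrite /ocomp /ozero lin0. Qed.
Lemma ocomprN O P : lin O -> ocomp O (oopp P) = oopp (ocomp O P) :> oper.
Proof. by move=> hO; apply: oeqP => f b; rewrite /ocomp /oopp linN. Qed.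

Lemma dot_dot r s : (0 < r)%N -> (0 < s)%N ->
  ocomp (dot r) (dot s) = ocomp (dot s) (dot r).
Proof.
have nnC k l : anchor k.+1 -> anchor l.+1 ->
    ocomp (off k (@down F)) (off l (@down F)) = ocomp (off l (@down F)) (off k (@down F)).
  move=> ak al;   case: (ltngtP k l) => [kl|kl|-> //].
    have := anchor_far ak al kl => ?; commute.
  have := anchor_far al ak kl => ?; symmetry; commute.
have ln k : lin (off k (@down F)) by apply/lin_off/lin_down.
have ln' k : lin (oopp (off k (@down F))) by apply/lin_opp/ln.
have lz := @lin_zero F.
case/dotP => [r'|k _ ak|k _ ak]; case/dotP => [s'|l _ al|l _ al] //.
- by rewrite ocompr0.
- by rewrite ocompr0.
- by rewrite ocompr0.
- by rewrite ocompN ocomprN // ocompN ocomprN // nnC.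
- by rewrite ocompN ocomprN // nnC.
- by rewrite ocompr0.
- by rewrite ocompN ocomprN // nnC.
- exact: nnC.
Qed.

Lemma psi_psi r s : (0 < r)%N -> (r.+1 < s)%N ->
  ocomp (psi r) (psi s) = ocomp (psi s) (psi r).
Proof.
move=> r_gt0 rs; have s_gt0 : (0 < s)%N by lia.
case: (psiP F e_ge3 r_gt0) rs => [|k k0 ak|k k0 ak|k k0 ak|k k0 ka kb kc];
  case: (psiP F e_ge3 s_gt0) => [|l l0 al|l l0 al|l l0 al|l l0 la lb lc] rs.
all: try by commute.
all: try by have := anchor_ge3 al isT => ?; commute.
all: try by have [? ? ?] := anchor_gen al ka kb kc; commute.
all: try by have [? ? ?] := anchor_gen ak la lb lc; commute.
all: try by have := anchor_far ak al => ?; commute.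
(* What remains is [psim] against [psi1]. If both belong to the same multiple of e, their windows
   share two letters and the identity is a separate computation. *)
have [->|ne] := eqVneq l k.+1.
  by rewrite offS -!off_comp psim_spsi1.
by have := anchor_far ak al => ?; commute.
Qed.

(** A nonzero y_s has s = a or s = a + 1 for a multiple a of e, and exchanges the letters a and a +
    1. The hypotheses exclude r = a; for r = a - 1 and r = a + 1 both products vanish, and otherwise
    the windows are disjoint. *)
Lemma psi_dot r s : (0 < r)%N -> (0 < s)%N -> s != r -> s != r.+1 ->
  ocomp (psi r) (dot s) = ocomp (dot s) (psi r).
Proof.
move=> r_gt0 s_gt0 sr srS.
have lp := lin_psi r.
suff nnC l : anchor l.+1 -> s = l.+1 \/ s = l.+2 ->
    ocomp (psi r) (off l (@down F)) = ocomp (off l (@down F)) (psi r).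
  case: (dotP s_gt0) nnC => [s'|l _ al|l _ al] nnC.
  - by rewrite ocomp0 ocompr0.
  - by rewrite ocompN ocomprN // nnC //; left.
  - by rewrite nnC //; right.
move=> al sl; have l_ge3 := anchor_ge3 al isT.
case: (psiP F e_ge3 r_gt0) sr srS => [|k k0 ak|k k0 ak|k k0 ak|k k0 ka kb kc] sr srS.
- by commute.
- have h1 := anchor_far ak al; have h2 := anchor_far al ak.
  have [?|?] : (k + 2 <= l)%N \/ (l + 2 <= k)%N by lia.
    by commute.
  by symmetry; commute.
- have h1 := anchor_far ak al; have h2 := anchor_far al ak.
  have [->|[?|?]] : l = k \/ (k + 3 <= l)%N \/ (l + 2 <= k)%N by lia.
  + by rewrite -!off_comp down_psi1 psi1_down.
  + by commute.
  + by symmetry; commute.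
- have h1 := anchor_far ak al; have h2 := anchor_far al ak.
  have [->|[?|?]] : l = k.+1 \/ (k + 3 <= l)%N \/ (l + 2 <= k)%N by lia.
  + by rewrite offS -!off_comp sdown_psim psim_sdown.
  + by commute.
  + by symmetry; commute.
- have [? ? ?] := anchor_gen al ka kb kc.
  have [?|?] : (k + 2 <= l)%N \/ (l + 2 <= k)%N by lia.
    by commute.
  by symmetry; commute.
Qed.

Definition sdrop k (b : stream) : stream := fun p => b (k + p)%N.

Lemma off_diag k (d : stream -> F) : off k (diag d) = diag (fun b => d (sdrop k b)).
Proof.
elim: k d => [|k IH] d; first by [].
by rewrite /= IH; apply: oeqP => f; elim/stream_ind1 => x b.
Qed.

(** The difference of consecutive residues at letters x, y, where c is the residue of an arm minus
    that of a leg at the first of the two positions. *)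
Definition step (x y : bool) (c : I) : I :=
  match x, y with
  | true, true => -1
  | false, false => 1
  | true, false => c
  | false, true => - c
  end.

Lemma rsd_step A P b k :
  rsd A P b k.+1 = rsd A P b k + step (b k) (b k.+1) (P + k%:R).
Proof.
elim: k A P b => [|k IH] A P b; last first.
  rewrite -[LHS]/(rsd _ _ (stl b) k.+1) IH /=; congr (_ + step _ _ _).
  by rewrite -addrA nat1r.
by rewrite /= /stl addr0; case: (b 0%N) (b 1%N) => -[] /=; ring.
Qed.

Variable K : I.
Local Notation rs := (rsd K 1).

Lemma rs_step b k : rs b k.+1 = rs b k + step (b k) (b k.+1) k.+1%:R.
Proof. by rewrite rsd_step nat1r. Qed.

Definition eq_coef r (b : stream) : F := (rs b r.-1 == rs b r)%:R.

Lemma eq_addr (x d : I) : (x == x + d) = (d == 0).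
Proof. by rewrite eq_sym -subr_eq0 addrC addKr. Qed.

(** At a multiple of e, [step] is 0 for distinct letters and a unit sign for equal ones. So the
    delta term tests for distinct letters, which is what [up_down] and [down_up] produce. *)
Lemma eq_coef_anchor k : anchor k.+1 -> off k (diag (@neq01 F)) = diag (eq_coef k.+1).
Proof.
move=> ak; rewrite off_diag; congr diag; apply/funext => b.
rewrite /neq01 /eq_coef /sdrop rs_step ak addn0 addn1 eq_addr /=.
by case: (b k) (b k.+1) => -[]; rewrite /= ?oppr_eq0 ?eqxx ?(negPf (oneI_neq0 e)).
Qed.

Lemma eq_coef_other k : k.+1%:R != 0 :> I -> diag (eq_coef k.+1) = @ozero F.
Proof.
move=> ak; apply: oeqP => f b; rewrite /diag /ozero.
rewrite /eq_coef rs_step eq_addr.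
by case: (b k) (b k.+1) => -[];
  rewrite /= ?oppr_eq0 ?(negPf ak) ?(negPf (oneI_neq0 e)) mul0r.
Qed.

Lemma oadd0 O : oadd O (@ozero F) = O.
Proof. by apply: oeqP => f b; rewrite /oadd addr0. Qed.

Lemma anchorS k : anchor k -> k.+1%:R != 0 :> I.
Proof. by move=> ak; rewrite -natr1 ak add0r oneI_neq0. Qed.

Lemma anchorP k : anchor k.+1 -> k%:R != 0 :> I.
Proof. by move=> /eqP ak; apply/eqP=> /anchorS; rewrite ak. Qed.

Lemma psi_dotS r : (0 < r)%N ->
  ocomp (psi r) (dot r.+1) = oadd (ocomp (dot r) (psi r)) (diag (eq_coef r)).
Proof.
move=> r_gt0; have lp := lin_psi r.
case: (psiP F e_ge3 r_gt0) lp => [|k k0 ak|k k0 ak|k k0 ak|k k0 ka kb kc] lp.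
- by rewrite ocomp0 ocompr0 // eq_coef_other ?oadd0 // oneI_neq0.
- by rewrite ocompN -!off_comp -off_opp -eq_coef_anchor // -off_add up_down.
- by rewrite ocompr0 // -off_comp down_psi1 off_zero eq_coef_other ?oadd0 // anchorS.
- by rewrite ocomp0 ocomprN // -off_comp psim_sdown off_zero eq_coef_other ?anchorP //;
    apply: oeqP => f b; rewrite /oopp /oadd /ozero oppr0 addr0.
- by rewrite ocomp0 ocompr0 // eq_coef_other ?oadd0.
Qed.

Lemma dotS_psi r : (0 < r)%N ->
  ocomp (dot r.+1) (psi r) = oadd (ocomp (psi r) (dot r)) (diag (eq_coef r)).
Proof.
move=> r_gt0; have lp := lin_psi r.
case: (psiP F e_ge3 r_gt0) lp => [|k k0 ak|k k0 ak|k k0 ak|k k0 ka kb kc] lp.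
- by rewrite ocomp0 ocompr0 // eq_coef_other ?oadd0 // oneI_neq0.
- by rewrite ocomprN // -!off_comp -off_opp -eq_coef_anchor // -off_add down_up.
- by rewrite ocomp0 -off_comp psi1_down off_zero eq_coef_other ?oadd0 // anchorS.
- by rewrite ocompr0 // ocompN -off_comp sdown_psim off_zero eq_coef_other ?anchorP //;
    apply: oeqP => f b; rewrite /oopp /oadd /ozero oppr0 addr0.
- by rewrite ocomp0 ocompr0 // eq_coef_other ?oadd0.
Qed.

End Relations.

(** * The quadratic and braid relations in the model *)

Section QuadraticAndBraid.
Variables (F : fieldType) (e : nat).
Hypothesis e_ge3 : (3 <= e)%N.
Local Notation V := (stream -> F).
Local Notation oper := (V -> V).
Local Notation I := 'Z_e.
Local Notation psi := (@psi_op F e).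
Local Notation dot := (@dot_op F e).
Local Notation anchor a := (a%:R = 0 :> I).
Variable K : I.
Local Notation rs := (rsd K 1).

Definition braid_coef r (b : stream) : F :=
  if (rs b r.+1 == rs b r.-1) && (rs b r == rs b r.-1 + 1) then 1
  else if (rs b r.+1 == rs b r.-1) && (rs b r.-1 == rs b r + 1) then -1
  else 0.

(** The residues at r and r + 2 differ by a sum of two steps. For constant words it is 2 or -2, for
    alternating words 1 or -1, so only the other four words can contribute. *)
Lemma braid_coefE k b : braid_coef k.+1 b =
  match b k, b k.+1, b k.+2 with
  | true, true, false => - (k.+1%:R == 0 :> I)%:R
  | false, false, true => (k.+1%:R == 0 :> I)%:R
  | true, false, false => - (k.+1%:R == -1 :> I)%:R
  | false, true, true => (k.+1%:R == -1 :> I)%:R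
  | _, _, _ => 0
  end.
Proof.
have h11 : (1 == -1 :> I) = false by apply/negbTE/one_neqN1.
have hm1 : (-1 == 1 :> I) = false by rewrite eq_sym.
have h2 : (1 + 1 == 0 :> I) = false by apply/negbTE/two_neq0.
have h1 : (1 == 0 :> I) = false by apply/negbTE/oneI_neq0.
have hm : (-1 == 0 :> I) = false by rewrite oppr_eq0.
have hm2 : (-1 - 1 == 0 :> I) = false by rewrite -opprD oppr_eq0.
rewrite /braid_coef succnK (rs_step K b k.+1) (rs_step K b k) -[k.+2%:R]natr1.
move: (rs b k) (k.+1%:R : I) => x c.
have e1 d d' : (x + d + d' == x) = (d + d' == 0) by rewrite -addrA eq_sym eq_addr.
have e2 d : (x + d == x + 1) = (d == 1) by rewrite (inj_eq (addrI x)).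
have e3 d : (x == x + d + 1) = (d == -1) by rewrite -addrA eq_addr addr_eq0.
rewrite e1 e2 e3.
case: (b k) (b k.+1) (b k.+2) => -[] [];
  rewrite /= ?h11 ?hm1 ?h2 ?h1 ?hm ?hm2 ?eqxx ?andbF ?andbT ?addNr //.
- by rewrite (_ : -1 + (c + 1) = c); [case: eqP; rewrite ?oppr0 | ring].
- by rewrite (_ : c - (c + 1) = -1) ?hm //; ring.
- rewrite addr_eq0; case: eqP => [->|_]; last by rewrite /= oppr0.
  by rewrite ?hm1 ?eqxx.
- rewrite -opprD oppr_eq0 addr_eq0; case: eqP => [->|_] //=.
  by rewrite ?opprK ?eqxx.
- by rewrite (_ : - c + (c + 1) = 1) ?h1 //; ring.
- by rewrite (_ : 1 - (c + 1) = - c) ?oppr_eq0; [case: eqP | ring].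
Qed.

Lemma one_eqN1 : (1 == -1 :> I) = false. Proof. exact/negbTE/one_neqN1. Qed.
Lemma N1_eq1 : (-1 == 1 :> I) = false. Proof. by rewrite eq_sym one_eqN1. Qed.
Lemma one_eq0 : (1 == 0 :> I) = false. Proof. exact/negbTE/oneI_neq0. Qed.
Lemma N1_eq0 : (-1 == 0 :> I) = false. Proof. by rewrite oppr_eq0 one_eq0. Qed.

Ltac bits k b := case: (b k) (b k.+1) (b k.+2) => -[] [] /=.

Lemma braid_coef_0 k : anchor k.+1 -> off k (@br0 F) = diag (braid_coef k.+1).
Proof.
move=> ak; rewrite /br0 off_add off_opp !off_diag; apply: oeqP => f b.
rewrite /oadd /oopp /diag braid_coefE /isw /sdrop addn0 addn1 addn2 ak eqxx [0 ==
  -1]eq_sym N1_eq0.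
by bits k b; rewrite ?mulN1r ?mul1r ?mul0r ?oppr0 ?addr0 ?add0r ?mul0r.
Qed.

Lemma braid_coef_m k : anchor k.+2 -> off k (@brm F) = diag (braid_coef k.+1).
Proof.
move=> ak; have {ak} ak : k.+1%:R = -1 :> I by apply/eqP; rewrite -addr_eq0 natr1 ak.
rewrite /brm off_add off_opp !off_diag; apply: oeqP => f b.
rewrite /oadd /oopp /diag braid_coefE /isw /sdrop addn0 addn1 addn2 ak eqxx N1_eq0.
by bits k b; rewrite ?mulN1r ?mul1r ?mul0r ?oppr0 ?addr0 ?add0r ?mul0r.
Qed.

Lemma braid_coef_other k : k.+1%:R != 0 :> I -> k.+2%:R != 0 :> I ->
  diag (braid_coef k.+1) = @ozero F.
Proof.
move=> /negPf k0; rewrite -natr1 addr_eq0 => /negPf km; apply: oeqP => f b.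
rewrite /diag braid_coefE /ozero k0 km.
by bits k b; rewrite ?oppr0 ?mul0r.
Qed.

Lemma psi_braid r : (0 < r)%N -> ocomp (psi r) (ocomp (psi r.+1) (psi r)) =
  oadd (ocomp (psi r.+1) (ocomp (psi r) (psi r.+1))) (diag (braid_coef r)).
Proof.
move=> r_gt0; have rS_gt0 : (0 < r.+1)%N by [].
move: rS_gt0; case: (psiP F e_ge3 r_gt0) => [|k k0 ak|k k0 ak|k k0 ak|k k0 ka kb kc] rS_gt0.
- rewrite braid_coef_other ?oneI_neq0 ?two_neq0 // oadd0.
  move def_s: 2%N rS_gt0 => s rS_gt0;
    case: (psiP F e_ge3 rS_gt0) def_s => [//|l l0 al|l l0 al|l l0 al|l l0 la lb lc] [El];
    subst.
  + by have := anchor_ge3 e_ge3 al isT.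
  + by [].
  + by rewrite -!off_comp braid_um.
  + by rewrite -!off_comp braid_us.
- rewrite -braid_coef_0 //.
  move def_s: k.+2 rS_gt0 => s rS_gt0;
    case: (psiP F e_ge3 rS_gt0) def_s => [//|l l0 al|l l0 al|l l0 al|l l0 la lb lc] [El];
    subst.
  + by have := anchorP al; rewrite ak eqxx.
  + by rewrite -!off_comp -off_add braid_0.
  + by have := anchor_far e_ge3 ak al; lia.
  + by have [] := anchor_gen ak la lb lc.
- have bk : k.+3%:R != 0 :> I.
    by apply/eqP => bk; have := anchor_far e_ge3 ak bk; lia.
  rewrite (braid_coef_other (anchorS ak) bk) oadd0.
  move def_s: k.+3 rS_gt0 => s rS_gt0;
    case: (psiP F e_ge3 rS_gt0) def_s => [//|l l0 al|l l0 al|l l0 al|l l0 la lb lc] [El];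
    subst.
  + by have := anchor_far e_ge3 ak al; lia.
  + by have := anchorP al; rewrite ak eqxx.
  + by rewrite !offS -!off_comp braid_1m.
  + by rewrite !offS -!off_comp braid_1s.
- rewrite -braid_coef_m //.
  move def_s: k.+2 rS_gt0 => s rS_gt0;
    case: (psiP F e_ge3 rS_gt0) def_s => [//|l l0 al|l l0 al|l l0 al|l l0 la lb lc] [El];
    subst.
  + by rewrite !offS -!off_comp -off_add braid_m.
  + by have := anchorP ak; rewrite al eqxx.
  + by have := anchorP al; rewrite ak eqxx.
  + by have [] := anchor_gen ak la lb lc.
- rewrite braid_coef_other //; last by rewrite -natr1 addr_eq0.
  rewrite oadd0.
  move def_s: k.+2 rS_gt0 => s rS_gt0;
    case: (psiP F e_ge3 rS_gt0) def_s => [//|l l0 al|l l0 al|l l0 al|l l0 la lb lc] [El];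
    subst.
  + by have [] := anchor_gen al ka kb kc.
  + by have [] := anchor_gen al ka kb kc.
  + by rewrite !offS -!off_comp braid_sm.
  + by rewrite !offS -!off_comp braid_ss.
Qed.

Definition quad r (f : V) (b : stream) : F :=
  if rs b r.-1 == rs b r then 0
  else if rs b r == rs b r.-1 + 1 then dot r.+1 f b - dot r f b
  else if rs b r.-1 == rs b r + 1 then dot r f b - dot r.+1 f b
  else f b.

Lemma quadE r f b : (0 < r)%N -> quad r f b =
  let d := step (b r.-1) (b r) (r%:R : I) in
  if d == 0 then 0 else if d == 1 then dot r.+1 f b - dot r f b
  else if d == -1 then dot r f b - dot r.+1 f b else f b.
Proof.
case: r => // k _; rewrite /quad succnK (rs_step K b k) eq_addr (inj_eq (addrI _)).
by rewrite -addrA eq_addr addr_eq0.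
Qed.

Lemma off_down k f b : off k (@down F) f b =
  if b k && ~~ b k.+1 then off k (@down F) f b else 0.
Proof.
elim: k f b => [|k IH] f b; first by rewrite /= /down; case: (b 0%N) (b 1%N) => -[].
by rewrite /= {1}/shift IH.
Qed.

Lemma off_off_diag k O P (d : stream -> F) f b : ocomp O O = ocomp (diag d) P ->
  off k O (off k O f) b = d (sdrop k b) * off k P f b.
Proof. 
move=> h; rewrite -[LHS]/(ocomp (off k O) (off k O) f b) -off_comp h off_comp off_diag //.
Qed.

Definition sgn j (b : stream) : F := if b j then 1 else -1.

Lemma psim_psim : ocomp (@psim F) (@psim F) = ocomp (diag (sgn 0)) (shift (@down F)).
Proof.
apply: oeqP => f; elim/stream_ind4 => -[] [] [] [] w;
by rewrite /ocomp /psim /diag /sgn /oadd /turn /down /up /shift /= ?stl_scons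
     ?opprK ?oppr0 ?addr0 ?add0r ?mul1r ?mulN1r ?oppr0.
Qed.

Lemma psi1_psi1 : ocomp (@psi1 F) (@psi1 F) = ocomp (diag (sgn 2)) (@down F).
Proof.
apply: oeqP => f; elim/stream_ind4 => -[] [] [] [] w;
by rewrite /ocomp /psi1 /diag /sgn /oadd /turn /down /up /shift /= ?stl_scons
     ?opprK ?oppr0 ?addr0 ?add0r ?mul1r ?mulN1r ?oppr0.
Qed.

(** Next to a multiple of e, the square of psi_r is the exchange defining y_r or y_{r+1}, with a
    sign read from the third letter of the window ([psi1_psi1], [psim_psim]). At r = 1 and at
    multiples of e it is 0, and for the other r it is the test for distinct letters. *)
Lemma psi_quad r f b : (0 < r)%N -> psi r (psi r f) b = quad r f b.
Proof.
move=> r_gt0; rewrite quadE //.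
case: (psiP F e_ge3 r_gt0) => [|k k0 ak|k k0 ak|k k0 ak|k k0 ka kb kc].
- rewrite -[LHS]/(ocomp (@up F) (@up F) f b) up_up /ozero /=.
  by case: (b 0%N) (b 1%N) => -[]; rewrite /= ?oppr_eq0 ?one_eq0 ?eqxx ?N1_eq1 ?subrr.
- rewrite -[LHS]/(ocomp (off k (@up F)) (off k (@up F)) f b)
    -off_comp up_up off_zero /ozero ak.
  rewrite /oopp off_down /=.
  by case: (b k) (b k.+1) => -[]; rewrite /= ?oppr_eq0 ?one_eq0 ?eqxx ?N1_eq1 ?oppr0 ?addr0.
- rewrite (off_off_diag k f b psi1_psi1)
    /ozero -[k.+2%:R]natr1 ak add0r /sgn /sdrop addn2 /=.
  by case: (b k.+1) (b k.+2) => -[];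
    rewrite /= ?oppr_eq0 ?one_eq0 ?eqxx ?N1_eq1 ?oppr0 ?mul1r ?mulN1r ?sub0r ?subr0
    ?addr0 ?opprK //.
- have -> : k.+1%:R = -1 :> I by apply/eqP; rewrite -addr_eq0 natr1 ak.
  rewrite (off_off_diag k f b psim_psim) /ozero /oopp /sgn /sdrop addn0 /=.
  by case: (b k) (b k.+1) => -[];
    rewrite /= ?opprK ?oppr_eq0 ?one_eq0 ?eqxx ?N1_eq1 ?mul1r ?mulN1r ?sub0r ?subr0
    ?addr0 ?opprK ?one_eqN1 ?add0r ?opprK //.
- rewrite -[LHS]/(ocomp (off k (@cross F)) (off k (@cross F)) f b)
    -off_comp cross_cross off_diag.
  rewrite /diag /neq01 /sdrop /ozero addn0 addn1 /=.
  by case: (b k) (b k.+1) => -[]; rewrite /= ?oppr_eq0 ?one_eq0 ?eqxx ?N1_eq1 ?subrr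
    ?mul0r ?mul1r ?(negPf ka) ?(negPf kb) ?(negPf kc) ?eqr_oppLR ?opprK ?(negPf kb)
      ?(negPf kc).
Qed.

End QuadraticAndBraid.

(** * The cyclotomic algebra acts on the model *)

Section PlacePermutations.
Variables (e n : nat).
Local Notation I := 'Z_e.

Definition mkres (rho : nat -> I) : n.-tuple I := [tuple rho k | k < n].

Lemma mkresE rho k : (k < n)%N -> nth 0 (mkres rho) k = rho k.
Proof. by move=> kn; rewrite -(tnth_nth 0 _ (Ordinal kn)) tnth_mktuple. Qed.

Lemma res_mkres rho r : (0 < r <= n)%N -> res (mkres rho) r = rho r.-1.
Proof. by case: r => // r /= rn; rewrite /res mkresE. Qed.

Lemma mkres_nth (i : n.-tuple I) : mkres (nth 0 i) = i.
Proof.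
apply: val_inj; apply: (@eq_from_nth _ 0) => [|k]; rewrite ?size_tuple // => kn;
  exact: mkresE.
Qed.

Lemma eq_mkres rho rho' : (forall k, (k < n)%N -> rho k = rho' k) -> mkres rho = mkres rho'.
Proof. by move=> h; apply: eq_from_tnth => k; rewrite !tnth_mktuple h. Qed.

Lemma sact_mkres r rho : (0 < r < n)%N -> sact r (mkres rho) = mkres (rho \o swp r.-1).
Proof.
case: r => // r /= rn; apply: eq_from_tnth => k; rewrite !tnth_mktuple /= /swp !eqSS.
have kn := ltn_ord k.
by case: eqP => _; [|case: eqP => _]; rewrite res_mkres //; lia.
Qed.

Lemma swpK k : involutive (swp k).
Proof.
move=> q; rewrite /swp; case: (eqVneq q k) => [->|h];
  first by rewrite eqxx (gtn_eqF (leqnn _)).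
by case: (eqVneq q k.+1) => [->|h']; rewrite ?eqxx // (negPf h) (negPf h').
Qed.

Lemma eq_sact r rho (i : n.-tuple I) : (0 < r < n)%N ->
  (mkres (rho \o swp r.-1) == i) = (mkres rho == sact r i).
Proof.
move=> rn; rewrite -(mkres_nth i) sact_mkres //.
have inv s : mkres ((s \o swp r.-1) \o swp r.-1) = mkres s.
  by apply: eq_mkres => k _ /=; rewrite swpK.
apply/eqP/eqP => E; first by rewrite -sact_mkres // -E sact_mkres // inv.
by rewrite -sact_mkres // E sact_mkres // inv.
Qed.
End PlacePermutations.

Section KLRAction.
Variables (F : fieldType) (e n : nat).
Hypothesis e_ge3 : (3 <= e)%N.
Local Notation V := (stream -> F).
Local Notation oper := (V -> V).
Local Notation I := 'Z_e.
Local Notation psi := (@psi_op F e).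
Local Notation dot := (@dot_op F e).
Variable K : I.
Local Notation rs := (rsd K 1).
Local Notation rst b := (mkres n (rs b)).

Definition proj (i : n.-tuple I) : oper := diag (fun b => (rst b == i)%:R).

Lemma lin_diag d : lin (@diag F d).
Proof. move=> a f g; apply/funext=> b; rewrite /diag /comb; ring. Qed.

Definition gen_op (x : klr_index e n) : oper :=
  match x with
  | inl (inl i) => proj i
  | inl (inr u) => dot (val u)
  | inr u => psi (val u)
  end.

Lemma gen_op_lin x : lin (gen_op x).
Proof. by case: x => [[i|u]|u]; [apply: lin_diag | apply: lin_dot | apply: lin_psi]. Qed.

Definition free_klr_action := free_action gen_op_lin.

Lemma free_klr_action_e i : free_klr_action (fe F i) = proj i.
Proof. by apply/funext => f;
  exact: free_act_var. Qed.

Lemma free_klr_action_y r : (0 < r <= n)%N -> free_klr_action (fy F e n r) = dot r.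
Proof.
by move=> rn; apply/funext => f; rewrite /fy insubT /free_klr_action /= free_act_var.
Qed.

Lemma free_klr_action_psi r : (0 < r < n)%N -> free_klr_action (fpsi F e n r) = psi r.
Proof.
by move=> rn; apply/funext => f; rewrite /fpsi insubT /free_klr_action /= free_act_var.
Qed.

Lemma act_bool (A : pzAlgType F) (rho : action stream A) (c : bool) f b :
  rho c%:R f b = c%:R * f b.
Proof. by case: c; rewrite ?act1 ?act0 ?mul1r ?mul0r. Qed.

Lemma act_delta (A : pzAlgType F) (rho : action stream A) x y z t (d : bool) :
  (forall f b, rho x (rho y (rho t f)) b = rho z (rho x (rho t f)) b + d%:R * rho t f b) ->
  rho (x * y * t) = rho ((z * x + d%:R) * t).
Proof.
move=> h; apply/funext => f; apply/funext => b.
by rewrite [in RHS]actM actD act_bool !actM.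
Qed.

Lemma act_delta_sym (A : pzAlgType F) (rho : action stream A) x y z t (d : bool) :
  (forall f b, rho y (rho x (rho t f)) b = rho x (rho z (rho t f)) b + d%:R * rho t f b) ->
  rho (y * x * t) = rho ((x * z + d%:R) * t).
Proof.
move=> h; apply/funext => f; apply/funext => b.
by rewrite [in RHS]actM actD act_bool !actM.
Qed.

Lemma act_quad (A : pzAlgType F) (rho : action stream A) x y t :
  (forall f b, rho x (rho x (rho t f)) b = rho y (rho t f) b) ->
  rho (x ^+ 2 * t) = rho (y * t).
Proof. by move=> h; apply/funext => f; apply/funext => b; rewrite expr2 !actM. Qed.

Lemma act_braid (A : pzAlgType F) (rho : action stream A) x y u t :
  (forall f b, rho x (rho y (rho x (rho t f))) b =
     rho y (rho x (rho y (rho t f))) b + rho u (rho t f) b) ->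
  rho (x * y * x * t) = rho ((y * x * y + u) * t).
Proof.
move=> h; apply/funext => f; apply/funext => b.
by rewrite [in RHS]actM actD !actM.
Qed.

Lemma dot_proj r i f : (0 < r)%N -> dot r (proj i f) = proj i (dot r f).
Proof.
move=> r_gt0; apply/funext => b.
exact: (@compat_dot F e e_ge3 r K r_gt0 (fun rho => (mkres n rho == i)%:R)).
Qed.

Lemma psi_proj r i f : (0 < r < n)%N -> psi r (proj i f) = proj (sact r i) (psi r f).
Proof.
move=> rn; have /andP[r_gt0 _] := rn; apply/funext => b.
rewrite [RHS]/proj /diag -eq_sact //.
exact: (@compat_psi F e e_ge3 r K r_gt0 (fun rho => (mkres n rho == i)%:R)).
Qed.

(** The left side uses the residues of i and the right side those of the word b. If they differ,
    [proj i f] and its images under the operators y vanish at b, so both sides are 0. *)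
Lemma free_klr_action_quad r i f b : (0 < r < n)%N ->
  free_klr_action (fquad F r i) (proj i f) b = quad K r (proj i f) b.
Proof.
move=> rn; have [r0 rn1 rn2] : [/\ 0 < r, 0 < r <= n & 0 < r.+1 <= n]%N by split; lia.
rewrite /fquad /quad.
have [<-|ne] := eqVneq (rst b) i; rewrite /arrow.
  rewrite !res_mkres // succnK.
  case: ifP => _; first by rewrite act0.
  case: ifP => _; first by rewrite actB !free_klr_action_y.
  by case: ifP => _; [rewrite actB !free_klr_action_y | rewrite act1].
have h s : (0 < s)%N -> dot s (proj i f) b = 0.
  by move=> s0; rewrite dot_proj // /proj /diag (negPf ne) mul0r.
have h0 : proj i f b = 0 by rewrite /proj /diag (negPf ne) mul0r.
rewrite !h // h0 subrr.
by do 6?case: ifP => _; rewrite ?act0 ?actB ?free_klr_action_y ?h ?subrr // act1.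
Qed.

Lemma free_klr_action_braid r i f b : (0 < r)%N -> (r.+1 < n)%N ->
  free_klr_action (fbraid F r i) (proj i f) b = braid_coef F K r b * proj i f b.
Proof.
move=> r0 rn; rewrite /fbraid /braid_coef.
have [<-|ne] := eqVneq (rst b) i; rewrite /arrow.
  rewrite !res_mkres ?succnK; try lia.
  case: ifP => _; first by rewrite act1 mul1r.
  by case: ifP => _; rewrite ?actN ?act1 ?mulN1r // act0 mul0r.
have h0 : proj i f b = 0 by rewrite /proj /diag (negPf ne) mul0r.
rewrite h0 mulr0.
by do 2?case: ifP => _; rewrite ?actN ?act1 ?act0 ?h0 ?oppr0.
Qed.

Lemma eq_coef_proj r i f b : (0 < r < n)%N ->
  eq_coef F K r b * proj i f b = (res i r == res i r.+1)%:R * proj i f b.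
Proof.
move=> rn; rewrite /proj /diag; case: eqP => [<-|]; last by rewrite mul0r !mulr0.
by rewrite !res_mkres //; lia.
Qed.

Lemma klr_rel_act x y : klr_rel x y -> free_klr_action x = free_klr_action y.
Proof.
case=> {x y}.
- move=> i j; apply/funext => f; rewrite actM !free_klr_action_e; apply/funext => b.
  rewrite /proj /diag; case: (eqVneq i j) => [<-|ij].
    by rewrite free_klr_action_e /proj /diag mulrA -natrM mulnb andbb.
  rewrite act0; case: eqP => [->|_]; last by rewrite mul0r.
  by rewrite (negPf ij) mul0r mulr0.
- apply/funext => f; apply/funext => b; rewrite act1 act_sum.
  rewrite (bigD1 (rst b)) // free_klr_action_e {1}/proj /diag eqxx mul1r big1 => [|i ne];
    first exact: addr0.
  by rewrite free_klr_action_e /proj /diag eq_sym (negPf ne) mul0r.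
- move=> r i rn; have /andP[r0 _] := rn; apply/funext => f.
  by rewrite [LHS]actM [RHS]actM free_klr_action_y // free_klr_action_e dot_proj.
- move=> r i rn; apply/funext => f;
    by rewrite [LHS]actM [RHS]actM free_klr_action_psi // !free_klr_action_e psi_proj.
- move=> r s rn sn; have /andP[r0 _] := rn; have /andP[s0 _] := sn.
  apply/funext => f; rewrite [LHS]actM [RHS]actM !free_klr_action_y //.
  by have := congr1 (fun O : oper => O f) (dot_dot F e_ge3 r0 s0).
- move=> r s rn sn sr srS; have /andP[r0 _] := rn; have /andP[s0 _] := sn.
  apply/funext => f; rewrite [LHS]actM [RHS]actM free_klr_action_y // free_klr_action_psi
    //.
  by have := congr1 (fun O : oper => O f) (psi_dot F e_ge3 r0 s0 sr srS).
- move=> r s rn sn; have /andP[r0 _] := rn; have /andP[s0 _] := sn.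
  case/orP => rs; apply/funext => f; rewrite [LHS]actM [RHS]actM !free_klr_action_psi //.
    by have := congr1 (fun O : oper => O f) (psi_psi F e_ge3 r0 rs).
  by have := congr1 (fun O : oper => O f) (psi_psi F e_ge3 s0 rs).
- move=> r i rn; have [r0 rn1 rn2] : [/\ 0 < r, 0 < r <= n & 0 < r.+1 <= n]%N by split; lia.
  apply: act_delta => f b; rewrite free_klr_action_e !free_klr_action_y //
    free_klr_action_psi // -eq_coef_proj //.
  by have := congr1 (fun O : oper => O (proj i f) b) (psi_dotS F e_ge3 K r0).
- move=> r i rn; have [r0 rn1 rn2] : [/\ 0 < r, 0 < r <= n & 0 < r.+1 <= n]%N by split; lia.
  apply: act_delta_sym => f b;
    rewrite free_klr_action_e !free_klr_action_y // free_klr_action_psi // -eq_coef_proj //.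
  by have := congr1 (fun O : oper => O (proj i f) b) (dotS_psi F e_ge3 K r0).
- move=> r i rn; have /andP[r0 _] := rn.
  by apply: act_quad => f b;
    rewrite free_klr_action_psi // free_klr_action_e (psi_quad e_ge3 K)
    // free_klr_action_quad.
- move=> r i r0 rn; have [rn1 rn2] : (0 < r < n)%N /\ (0 < r.+1 < n)%N by split; lia.
  apply: act_braid => f b; rewrite free_klr_action_e !free_klr_action_psi //
    free_klr_action_braid //.
  by have := congr1 (fun O : oper => O (proj i f) b) (psi_braid F e_ge3 K r0).
Qed.

Definition klr_action : action stream (klr F e n) := presalg_action klr_rel_act.

Lemma klr_actionE x : klr_action (presalg_pi _ x) = free_klr_action x.
Proof. exact: (presalg_actE klr_rel_act). Qed.

Hypothesis n_gt0 : (0 < n)%N.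

(** As y_1 acts by 0, only the exponent 0 matters. Then i_1 is neither k1 nor k2, whereas the first
    residue of a word is K or K + 1, so e(i) acts by 0. *)
Lemma cyc_rel_act x y : cyc_rel (K + 1) K x y -> klr_action x = klr_action y.
Proof.
case=> i; apply/funext => f; apply/funext => b;
  rewrite actM act0 /he klr_actionE free_klr_action_e.
case def_c: (_ + _)%N => [|c]; last first.
  by rewrite exprS actM /hy klr_actionE free_klr_action_y // /dot_op /= /ozero.
rewrite expr0 act1 /proj /diag; case: eqP => [E|]; last by rewrite mul0r.
move: def_c; rewrite -E res_mkres /= ?addn1; last by lia.
by case: (b 0%N); rewrite ?addr0 eqxx // addnC.
Qed.

Definition cyc_action : action stream (cyc F n (K + 1) K) := presalg_action cyc_rel_act.

Lemma cyc_actionE x : cyc_action (presalg_pi _ (presalg_pi _ x)) = free_klr_action x.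
Proof. by rewrite -klr_actionE; exact: (presalg_actE cyc_rel_act). Qed.

Lemma cyc_action_e i : cyc_action (ce F (K + 1) K i) = proj i.
Proof. by rewrite /ce /he cyc_actionE free_klr_action_e. Qed.
Lemma cyc_action_y r : (0 < r <= n)%N -> cyc_action (cy F n (K + 1) K r) = dot r.
Proof. by move=> rn; rewrite /cy /hy cyc_actionE free_klr_action_y. Qed.
Lemma cyc_action_psi r : (0 < r < n)%N -> cyc_action (cpsi F n (K + 1) K r) = psi r.
Proof. by move=> rn; rewrite /cpsi /hpsi cyc_actionE free_klr_action_psi. Qed.
End KLRAction.

(** * Modules over the cyclotomic algebra *)

Section PresentedModules.
Variables (R : pzRingType) (rel : R -> R -> Prop).
Local Notation M := (presmod rel).
Local Notation z := (presmod_gen rel).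

Lemma presmod_genE (a : R) : a *: z = modquot_pi _ (a : R^o).
Proof.
rewrite /presmod_gen -[LHS]/(modquot_scale a (modquot_pi _ _)) modquot_scaleE.
by congr modquot_pi; exact: mulr1.
Qed.

Lemma presmod_cyclic (x : M) : exists a, x = a *: z.
Proof. by elim/modquot_ind: x => a; exists a; rewrite presmod_genE. Qed.

Lemma presmod_rel a b : rel a b -> a *: z = b *: z.
Proof.
move=> ab; rewrite !presmod_genE; apply/modquot_eq/asboolP/span_gen.
by exists a, b.
Qed.

End PresentedModules.

Section PresentedActions.
Variables (F : fieldType) (T : Type) (A : pzAlgType F) (rho : action T A).
Variables (rel : A -> A -> Prop) (f0 : T -> F).
Hypothesis rel_f0 : forall a b, rel a b -> rho a f0 = rho b f0.
Local Notation M := (presmod rel).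

(** The module map sending the generator to f0, computed on a representative; [rel_f0] makes the
    choice irrelevant. *)
Definition presmod_fun (x : M) : T -> F := rho (repr x : A^o) f0.

Lemma presmod_fun_pi (a : A) : presmod_fun (modquot_pi _ (a : A^o)) = rho a f0.
Proof.
rewrite /presmod_fun; set u := modquot_pi _ (a : A^o).
have /asboolP h := modquot_repr (Defs.span (fun x : A^o =>
  exists a b, rel a b /\ x = a - b)) (a : A^o).
have {h} h0 : rho (a - (repr u : A^o)) f0 = fun=> 0.
  rewrite -/u in h; elim: h => [_ [b [c [bc ->]]]||b x y _ IHx _ IHy].
  - by apply/funext => t; rewrite actB (rel_f0 bc) subrr.
  - by apply/funext => t; rewrite act0.
  - apply/funext => t; rewrite -[b *: x]/((b : A) * x) actD actM.
    by rewrite [rho x f0]IHx [rho y f0]IHy act_zero addr0.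
apply/funext => t; apply/eqP; rewrite eq_sym -subr_eq0 -actB; apply/eqP.
exact: (congr1 (@^~ t) h0).
Qed.

Lemma presmod_fun_gen a : presmod_fun (a *: presmod_gen rel) = rho a f0.
Proof. by rewrite presmod_genE presmod_fun_pi. Qed.

Lemma presmod_funZ a x : presmod_fun (a *: x) = rho a (presmod_fun x).
Proof.
have [b ->] := presmod_cyclic x.
by rewrite scalerA !presmod_fun_gen actM.
Qed.

Lemma presmod_funD x y t : presmod_fun (x + y) t = presmod_fun x t + presmod_fun y t.
Proof.
have [b ->] := presmod_cyclic x; have [c ->] := presmod_cyclic y.
by rewrite -scalerDl !presmod_fun_gen actD.
Qed.

End PresentedActions.

Section RelationImages.
Variables (A B : pzRingType) (f : A -> B).
Hypotheses (fM : {morph f : x y / x * y}) (fD : {morph f : x y / x + y}).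
Hypothesis f_bool : forall c : bool, f c%:R = c%:R.

Lemma image_rel2 a b c d : f (a * b) = f (c * d) -> f a * f b = f c * f d.
Proof. by rewrite !fM. Qed.

Lemma image_delta a b c d x (t : bool) :
  f (a * b * x) = f ((c * d + t%:R) * x) -> f a * f b * f x = (f c * f d + t%:R) * f x.
Proof. by rewrite !fM fD fM f_bool. Qed.

Lemma image_quad a b x : f (a ^+ 2 * x) = f (b * x) -> f a * f a * f x = f b * f x.
Proof. by rewrite expr2 !fM. Qed.

Lemma image_braid a b c x : f (a * b * a * x) = f ((b * a * b + c) * x) ->
  f a * f b * f a * f x = (f b * f a * f b + f c) * f x.
Proof. by rewrite !fM fD !fM. Qed.
End RelationImages.

Section CycRelations.
Variables (F : fieldType) (e n : nat) (k1 k2 : 'Z_e).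
Local Notation A := (cyc F n k1 k2).
Local Notation ce := (ce F k1 k2).
Local Notation cy := (cy F n k1 k2).
Local Notation cpsi := (cpsi F n k1 k2).

Definition cyc_pi (x : freealg F (klr_index e n)) : A := presalg_pi _ (presalg_pi _ x).

Lemma cyc_piM x y : cyc_pi (x * y) = cyc_pi x * cyc_pi y.
Proof. by rewrite /cyc_pi !rmorphM. Qed.
Lemma cyc_piD x y : cyc_pi (x + y) = cyc_pi x + cyc_pi y.
Proof. by rewrite /cyc_pi !rmorphD. Qed.
Lemma cyc_pi1 : cyc_pi 1 = 1.
Proof. by rewrite /cyc_pi !rmorph1. Qed.
Lemma cyc_pi0 : cyc_pi 0 = 0.
Proof. by rewrite /cyc_pi !rmorph0. Qed.
Lemma cyc_piN x : cyc_pi (- x) = - cyc_pi x.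
Proof. by rewrite /cyc_pi !rmorphN. Qed.
Lemma cyc_pi_bool (c : bool) : cyc_pi c%:R = c%:R.
Proof. by case: c; rewrite ?cyc_pi1 ?cyc_pi0. Qed.

Lemma cyc_pi_rel x y : klr_rel x y -> cyc_pi x = cyc_pi y.
Proof. by move=> h; rewrite /cyc_pi (presalg_rel h). Qed.

Lemma cpsi_ce r i : (0 < r < n)%N -> cpsi r * ce i = ce (sact r i) * cpsi r.
Proof. by move=> rn; apply/(image_rel2 cyc_piM)/cyc_pi_rel/klr_psie. Qed.

Lemma cpsi_cy r s : (0 < r < n)%N -> (0 < s <= n)%N -> s != r -> s != r.+1 ->
  cpsi r * cy s = cy s * cpsi r.
Proof. by move=> rn sn h1 h2; apply/(image_rel2 cyc_piM)/cyc_pi_rel/klr_psiy. Qed.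

Lemma cpsi_out r : ~~ (0 < r < n)%N -> cpsi r = 0.
Proof. by move=> rn; rewrite /cpsi /hpsi /fpsi insubN // !rmorph0. Qed.

Lemma cpsi_comm r s : (r.+1 < s)%N || (s.+1 < r)%N -> cpsi r * cpsi s = cpsi s * cpsi r.
Proof.
move=> rs; have [rn|/cpsi_out->] := boolP (0 < r < n)%N; last by rewrite mul0r mulr0.
have [sn|/cpsi_out->] := boolP (0 < s < n)%N; last by rewrite mul0r mulr0.
exact/(image_rel2 cyc_piM)/cyc_pi_rel/klr_psipsi.
Qed.

Lemma cpsi_cyS r i : (0 < r < n)%N ->
  cpsi r * cy r.+1 * ce i = (cy r * cpsi r + (res i r == res i r.+1)%:R) * ce i.
Proof. by move=> rn; apply/(image_delta cyc_piM cyc_piD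
  cyc_pi_bool)/cyc_pi_rel/klr_psiyS. Qed.

Lemma cyS_cpsi r i : (0 < r < n)%N ->
  cy r.+1 * cpsi r * ce i = (cpsi r * cy r + (res i r == res i r.+1)%:R) * ce i.
Proof. by move=> rn; apply/(image_delta cyc_piM cyc_piD
  cyc_pi_bool)/cyc_pi_rel/klr_ySpsi. Qed.

Lemma cpsi_quad r i : (0 < r < n)%N -> 
  cpsi r * cpsi r * ce i = cyc_pi (fquad F r i) * ce i.
Proof. by move=> rn; apply/(image_quad cyc_piM)/cyc_pi_rel/klr_quad. Qed.

Lemma cpsi_braid r i : (0 < r)%N -> (r.+1 < n)%N ->
  cpsi r * cpsi r.+1 * cpsi r * ce i =
  (cpsi r.+1 * cpsi r * cpsi r.+1 + cyc_pi (fbraid F r i)) * ce i.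
Proof. by move=> r0 rn; apply/(image_braid cyc_piM cyc_piD)/cyc_pi_rel/klr_braid. Qed.

(** Elements are combinations of monomials in the generators, and monomials are peeled from the left
    because the algebra acts from the left. *)
Lemma cyc_ind (P : A -> Prop) :
  P 1 -> (forall x y, P x -> P y -> P (x + y)) ->
  (forall a x, P x -> P (Defs.scalar a * x)) ->
  (forall i x, P x -> P (ce i * x)) ->
  (forall r x, (0 < r <= n)%N -> P x -> P (cy r * x)) ->
  (forall r x, (0 < r < n)%N -> P x -> P (cpsi r * x)) -> forall x, P x.
Proof.
move=> P1 PD PZ Pe Py Pp; elim/presalg_ind; elim/presalg_ind => u;
  rewrite -[X in P X]/(cyc_pi u).
have P0 : P 0 by rewrite -(mul0r 1) -(rmorph0 (Defs.scalar : {rmorphism F -> A}));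
  apply: PZ.
elim/freealg_ind: u => [|u v Pu Pv|c k]; [by rewrite cyc_pi0 | by rewrite cyc_piD;
  apply: PD |].
have -> : << c *g k >> = (Defs.scalar c : freealg F (klr_index e n))
  * (<< k >> : freealg F (klr_index e n)).
  by rewrite malgM_def fgmulUU mulr1 mul1m.
rewrite cyc_piM; apply: (PZ c); case: k => k.
elim: k => [|x k IH].
  by rewrite (_ : << _ >> = 1 :> freealg F (klr_index e n)) ?cyc_pi1 // -fmoneE.
have -> : << FMonom (x :: k)
  >> = freealg_var F x * (<< FMonom k >> : freealg F (klr_index e n)).
  by rewrite malgM_def fgmulUU mulr1; congr << _ *g _ >>;
    rewrite -[mmul _ _]/(fmmul _ _) fmuE fmmulE.
rewrite cyc_piM; case: x => [[i|[r rn]]|[r rn]].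
- exact: Pe.
- by have := Py r _ rn IH; rewrite /cy /hy /fy insubT.
- by have := Pp r _ rn IH; rewrite /cpsi /hpsi /fpsi insubT.
Qed.

End CycRelations.

(** * The standard basis spans *)

Section Words.

Definition stream_of (t : seq bool) : stream := nth false t.

Lemma stream_of_cons x t : stream_of (x :: t) = scons x (stream_of t).
Proof. by apply/funext => -[]. Qed.

Lemma descentP (t : seq bool) :
  (exists pre post, t = pre ++ false :: true :: post) \/
  t = nseq (count id t) true ++ nseq (size t - count id t) false.
Proof.
elim: t => [|x s [[pre [post ->]]|E]]; [by right | by left; exists (x :: pre), post |].
case: x; first by right; rewrite {1}E.
case c: (count id s) E => [|k] E.
  by right; rewrite {1}E /= c !subn0.
by left; exists [::], (nseq k true ++ nseq (size s - k.+1) false); rewrite {1}E.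
Qed.

(** Counts the pairs of an arm before a leg; this is the number of factors psi in the standard
    vector of t. *)
Fixpoint ninv (t : seq bool) : nat :=
  if t is x :: s then ninv s + (if x then 0 else count id s) else 0.

Lemma ninv_swap pre post :
  ninv (pre ++ false :: true :: post) = (ninv (pre ++ true :: false :: post)).+1.
Proof.
elim: pre => [|x pre IH] /=; first by lia.
by rewrite IH !count_cat /=; case: x; lia.
Qed.

Lemma nth_swap pre post (x y : bool) r : r != size pre -> r != (size pre).+1 ->
  nth false (pre ++ x :: y :: post) r = nth false (pre ++ y :: x :: post) r.
Proof.
move=> h1 h2; rewrite !nth_cat; case: ltnP => // h.
by have -> : (r - size pre = (r - size pre).-2.+2)%N by lia.
Qed.

Lemma nth_at (pre s : seq bool) k : nth false (pre ++ s) (size pre + k) = nth false s k.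
Proof. by rewrite nth_cat ltnNge leq_addr addKn. Qed.

End Words.

Section Residues.
Variable e : nat.
Local Notation I := 'Z_e.

Lemma rsdE (A P : I) b q : rsd A P b q =
  A - (\sum_(i < q) b i)%N%:R + (if b q then 0 else P + q%:R).
Proof.
elim: q A P b => [|q IH] A P b; first by rewrite big_ord0 subr0 addr0.
rewrite /= IH big_ord_recl natrD opprD addrA /stl -addrA -nat1r [1 + _]addrC.
by congr (_ + _); case: (b _) => //; rewrite addrA [P + 1 + _]addrAC.
Qed.

Lemma rsd_swap (A P : I) pre post :
  rsd A P (stream_of (pre ++ false :: true :: post)) =
  rsd A P (stream_of (pre ++ true :: false :: post)) \o swp (size pre).
Proof.
elim: pre A P => [|x pre IH] A P /=.
  rewrite !stream_of_cons; apply/funext => -[|[|q]]; rewrite /= ?stl_scons; try ring.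
  by congr (rsd _ _ _ _); ring.
rewrite !stream_of_cons !rsdS IH -sshift_swp.
by apply/funext => -[].
Qed.
End Residues.

(** The consequences of the presentation on which straightening relies. Of the quadratic and braid
    relations only the shape is kept: which kind of factor q occurs, and that the braid correction
    is a scalar. *)
Record klr_family (F : fieldType) (e n : nat) (A : pzAlgType F) := KlrFamily {
  gce : n.-tuple 'Z_e -> A;
  gcy : nat -> A;
  gcpsi : nat -> A;
  gce_ce : forall i j, gce i * gce j = if i == j then gce i else 0;
  gcpsi_comm : forall r s, (r.+1 < s)%N || (s.+1 < r)%N ->
    gcpsi r * gcpsi s = gcpsi s * gcpsi r;
  gcpsi_ce : forall r i, (0 < r < n)%N -> gcpsi r * gce i = gce (sact r i) * gcpsi r;
  gcpsi_cy : forall r s, (0 < r < n)%N -> (0 < s <= n)%N -> s != r -> s != r.+1 ->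
    gcpsi r * gcy s = gcy s * gcpsi r;
  gcpsi_cyS : forall r i, (0 < r < n)%N ->
    gcpsi r * gcy r.+1 * gce i = (gcy r * gcpsi r + (res i r == res i r.+1)%:R) * gce i;
  gcyS_cpsi : forall r i, (0 < r < n)%N ->
    gcy r.+1 * gcpsi r * gce i = (gcpsi r * gcy r + (res i r == res i r.+1)%:R) * gce i;
  gcpsi_quad : forall r i, (0 < r < n)%N ->
    exists2 q, gcpsi r * gcpsi r * gce i = q * gce i &
    [\/ q = 0, q = gcy r.+1 - gcy r, q = gcy r - gcy r.+1 | q = 1];
  gcpsi_braid : forall r i, (0 < r)%N -> (r.+1 < n)%N ->
    exists c : F, gcpsi r * gcpsi r.+1 * gcpsi r * gce i =
      (gcpsi r.+1 * gcpsi r * gcpsi r.+1 + Defs.scalar c) * gce i;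
  gcyc_ind : forall P : A -> Prop,
    P 1 -> (forall x y, P x -> P y -> P (x + y)) ->
    (forall a x, P x -> P (Defs.scalar a * x)) ->
    (forall i x, P x -> P (gce i * x)) ->
    (forall r x, (0 < r <= n)%N -> P x -> P (gcy r * x)) ->
    (forall r x, (0 < r < n)%N -> P x -> P (gcpsi r * x)) -> forall x, P x }.

Section Spanning.
Variables (F : fieldType) (e n : nat) (A : pzAlgType F) (g : klr_family e n A).
Local Notation ce := (gce g).
Local Notation cy := (gcy g).
Local Notation cpsi := (gcpsi g).
Let cpsi_comm := @gcpsi_comm _ _ _ _ g.
Let cpsi_ce := @gcpsi_ce _ _ _ _ g.
Let cpsi_cy := @gcpsi_cy _ _ _ _ g.
Let cpsi_cyS := @gcpsi_cyS _ _ _ _ g.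
Let cyS_cpsi := @gcyS_cpsi _ _ _ _ g.
Let cpsi_quad := @gcpsi_quad _ _ _ _ g.
Let cpsi_braid := @gcpsi_braid _ _ _ _ g.

Variables (K : 'Z_e) (m : nat).
Hypothesis m_le_n : (m <= n)%N.
Local Notation rst b := (mkres n (rsd K 1 b)).

Definition init_tab : seq bool := nseq m true ++ nseq (n - m) false.
Definition valid (t : seq bool) := (size t == n) && (count id t == m).

Variables (S : lmodType A) (z : S).
Hypothesis ce_z : ce (rst (stream_of init_tab)) *: z = z.
Hypothesis cy_z : forall r, (0 < r <= n)%N -> cy r *: z = 0.
Hypothesis cpsi_z : forall r, (0 < r < n)%N -> r != m -> cpsi r *: z = 0.

Definition gpsi_down (b a : nat) : A := \prod_(r <- rev (index_iota a b)) cpsi r.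

Lemma gpsi_down_nil a : gpsi_down a a = 1.
Proof. by rewrite /gpsi_down /index_iota subnn big_nil. Qed.

Lemma gpsi_downS b a : (a <= b)%N -> gpsi_down b.+1 a = cpsi b * gpsi_down b a.
Proof.
move=> ab; rewrite /gpsi_down /index_iota subSn // -[(b - a).+1]addn1 iotaD /= subnKC //
  cats1.
by rewrite rev_rcons big_cons.
Qed.

Lemma gpsi_down_comm r b a : (b < r)%N -> cpsi r * gpsi_down b a = gpsi_down b a * cpsi r.
Proof.
move=> br; have [ab|ba] := leqP a b; last first.
  by rewrite /gpsi_down /index_iota (_ : b - a = 0)%N ?big_nil ?mulr1 ?mul1r //; lia.
elim: b ab br => [|b IH]; first by rewrite leqn0 => /eqP-> _;
  rewrite gpsi_down_nil mulr1 mul1r.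
rewrite leq_eqVlt => /predU1P[-> _|]; first by rewrite gpsi_down_nil mulr1 mul1r.
rewrite ltnS => ab br; rewrite gpsi_downS // mulrA cpsi_comm ?br ?orbT // -mulrA IH //;
  last lia.
by rewrite mulrA.
Qed.

(** Here p is the position of the first letter of t, and j the index of the next leg. *)
Fixpoint tab_op (t : seq bool) (p j : nat) : A :=
  if t is x :: s then
    if x then gpsi_down p j * tab_op s p.+1 j.+1 else tab_op s p.+1 j
  else 1.

Definition stdvec (t : seq bool) : S := tab_op t 1 1 *: z.

Lemma tab_op_cat s t p j :
  tab_op (s ++ t) p j = tab_op s p j * tab_op t (p + size s) (j + count id s).
Proof.
elim: s p j => [|x s IH] p j; first by rewrite mul1r !addn0.
by case: x => /=; rewrite IH ?mulrA !addSnnS // addnA addn1.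
Qed.

Lemma tab_op_comm s p j r : (p + size s <= r)%N ->
  cpsi r * tab_op s p j = tab_op s p j * cpsi r.
Proof.
elim: s p j => [|x s IH] p j /= h; first by rewrite mulr1 mul1r.
case: x; last by rewrite IH //; lia.
rewrite mulrA gpsi_down_comm; last by lia.
by rewrite -!mulrA IH //; lia.
Qed.

(** Moving the leg one place back prepends psi_{|pre|+1} to its factor. This generator commutes with
    the factors of pre, whose indices are smaller by at least two. *)
Lemma stdvec_swap pre post :
  stdvec (pre ++ false :: true :: post)
    = cpsi (size pre).+1 *: stdvec (pre ++ true :: false :: post).
Proof.
rewrite /stdvec scalerA !tab_op_cat /= [in RHS]mulrA tab_op_comm ?add1n // -!mulrA;
  congr ((_ * _) *: _).
by rewrite mulrA -gpsi_downS // ltnS count_size.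
Qed.

Lemma valid_swap pre post :
  valid (pre ++ false :: true :: post) = valid (pre ++ true :: false :: post).
Proof. by rewrite /valid !size_cat !count_cat /=. Qed.

Lemma validP t : valid t -> (exists pre post, t = pre ++ false :: true :: post)
  \/ t = init_tab.
Proof.
case/andP => /eqP sz /eqP ct; have [|] := descentP t; first by left.
by rewrite sz ct; right.
Qed.

Lemma tab_op_true a s p : tab_op (nseq a true ++ nseq s false) p p = 1.
Proof.
elim: a p => [|a IH] p /=; last by rewrite gpsi_down_nil mul1r IH.
by elim: s {1}p => //= s IH q; rewrite IH.
Qed.

Lemma stdvec_init_tab : stdvec init_tab = z.
Proof. by rewrite /stdvec tab_op_true ?scale1r. Qed.

Lemma stream_of_init_tab q : stream_of init_tab q = (q < m)%N.
Proof.
rewrite /stream_of /init_tab nth_cat size_nseq nth_nseq; case: ltnP => //; rewrite nth_nseq.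
by case: ifP.
Qed.

Lemma rst_swap pre post : ((size pre).+1 < n)%N ->
  rst (stream_of (pre ++ false :: true :: post)) =
  sact (size pre).+1 (rst (stream_of (pre ++ true :: false :: post))).
Proof. by move=> h; rewrite sact_mkres // rsd_swap. Qed.

Lemma ce_stdvec t : valid t -> ce (rst (stream_of t)) *: stdvec t = stdvec t.
Proof.
have [k] := ubnP (ninv t); elim: k t => // k IH t; rewrite ltnS => inv_t vt.
have [[pre [post Et]]|->] := validP vt; last by rewrite stdvec_init_tab ce_z.
move: vt inv_t; rewrite Et valid_swap ninv_swap => vt inv_t.
have sz : ((size pre).+1 < n)%N.
  by case/andP: vt => /eqP <- _; rewrite size_cat /=; lia.
rewrite stdvec_swap rst_swap // scalerA -cpsi_ce // -scalerA IH //.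
Qed.

Definition fscale (a : F) (x : S) : S := (Defs.scalar a : A) *: x.

Lemma fscaleZ a (c : A) x : c *: fscale a x = fscale a (c *: x).
Proof. by rewrite /fscale !scalerA (scalar_central a c). Qed.

(* Straightening: if the letters r and r + 1 of t are equal then psi_r v(t)   *)
(* only involves words with fewer inversions than t.                          *)
Inductive filt (k : nat) : S -> Prop :=
| filt_gen t of valid t & (ninv t < k)%N : filt k (stdvec t)
| filt0 : filt k 0
| filtD x y of filt k x & filt k y : filt k (x + y)
| filt_scale a x of filt k x : filt k (fscale a x).

Lemma filt_le k l x : (k <= l)%N -> filt k x -> filt l x.
Proof.
move=> kl; elim=> [t vt lt||x' y _ IHx _ IHy|a x' _ IH].
- by apply: filt_gen => //; apply: leq_trans lt kl.
- exact: filt0.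
- exact: filtD.
- exact: filt_scale.
Qed.

Lemma filtN k x : filt k x -> filt k (- x).
Proof.
move=> /(filt_scale (-1)); rewrite /fscale (rmorphN1 (Defs.scalar : {rmorphism F -> A})).
by rewrite scaleN1r.
Qed.

Lemma filtB k x y : filt k x -> filt k y -> filt k (x - y).
Proof. by move=> hx /filtN; apply: filtD. Qed.

Lemma filt_act k l (c : A) x :
  (forall t, valid t -> (ninv t < k)%N -> filt l (c *: stdvec t)) -> filt k x ->
    filt l (c *: x).
Proof.
move=> h; elim=> [t vt lt||x' y _ IHx _ IHy|a x' _ IH].
- exact: h.
- by rewrite scaler0; apply: filt0.
- by rewrite scalerDr; apply: filtD.
- by rewrite fscaleZ; apply: filt_scale.
Qed.

Lemma valid_size t : valid t -> size t = n.
Proof. by case/andP => /eqP. Qed.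

Definition spanned (t : seq bool) :=
  [/\ forall r, (0 < r <= n)%N -> filt (ninv t) (cy r *: stdvec t),
      forall r, (0 < r < n)%N -> filt (ninv t).+2 (cpsi r *: stdvec t) &
      forall r, (0 < r < n)%N -> nth false t r.-1 = nth false t r ->
        filt (ninv t) (cpsi r *: stdvec t)].

Lemma spanned_init_tab : spanned init_tab.
Proof.
rewrite /spanned stdvec_init_tab; split=> r rn.
- by rewrite cy_z //; apply: filt0.
- have [E|ne] := eqVneq r m; last by rewrite cpsi_z //; apply: filt0.
  have Et : init_tab = nseq r.-1 true ++ true :: false :: nseq (n - m).-1 false.
    rewrite /init_tab -E (_ : n - r = (n - r).-1.+1)%N; last by lia.
    by case: (r) rn => // r' _; rewrite -{1}[r'.+1]addn1 nseqD -catA.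
  have sz : (size (nseq r.-1 true)).+1 = r by rewrite size_nseq; lia.
  have := stdvec_swap (nseq r.-1 true) (nseq (n - m).-1 false).
  rewrite sz -Et stdvec_init_tab => <-; apply: filt_gen;
    rewrite ?valid_swap ?ninv_swap -Et //.
  by rewrite /valid /init_tab size_cat count_cat !size_nseq !count_nseq mul1n mul0n addn0
    subnKC ?eqxx.
- rewrite -!/(stream_of _ _) !stream_of_init_tab => E; rewrite cpsi_z;
    [exact: filt0 | done |].
  by apply/eqP => rm; move: E; rewrite rm ltnn ltn_predL; lia.
Qed.

(** Induction on inversions: v(t) = psi_s v(t') with t' one inversion shorter. By induction y lowers
    and psi raises the filtration by one, and the relations move the new generator past psi_s. *)
Lemma spanP t : valid t -> spanned t.
Proof.
have [k] := ubnP (ninv t); elim: k t => // k IH t; rewrite ltnS => inv_t vt.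
have IHy l r x : (l <= ninv t)%N -> (0 < r <= n)%N -> filt l x -> filt l.-1 (cy r *: x).
  move=> lk rn; apply: filt_act => u vu lu; have [|h _ _] := IH u _ vu; first by lia.
  by apply: filt_le (h r rn); lia.
have IHp l r x : (l <= ninv t)%N -> (0 < r < n)%N -> filt l x -> filt l.+1 (cpsi r *: x).
  move=> lk rn; apply: filt_act => u vu lu; have [|_ h _] := IH u _ vu; first by lia.
  by apply: filt_le (h r rn); lia.
have IHe u r : valid u -> (ninv u < ninv t)%N -> (0 < r < n)%N ->
    nth false u r.-1 = nth false u r -> filt (ninv u) (cpsi r *: stdvec u).
  by move=> vu ut rn; have [|_ _] := IH u _ vu; [lia | apply].
have weight u (a b : A) : valid u ->
    a * ce (rst (stream_of u)) = b * ce (rst (stream_of u)) ->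
      a *: stdvec u = b *: stdvec u.
  by move=> vu E; rewrite -(ce_stdvec vu) !scalerA E.
have down pre post : t = pre ++ false :: true :: post ->
    exists t', [/\ t' = pre ++ true :: false :: post, valid t', ninv t = (ninv t').+1,
      stdvec t = cpsi (size pre).+1 *: stdvec t' & (0 < (size pre).+1 < n)%N].
  move=> Et; exists (pre ++ true :: false :: post).
  rewrite -valid_swap -stdvec_swap -ninv_swap -Et; split=> //.
  by rewrite -(valid_size vt) Et size_cat /=; lia.
(* Here psi_s meets psi_s v(t'), and the quadratic relation leaves 0, v(t') or a difference of two
   y's applied to v(t'). *)
have psi_down pre post : t = pre ++ false :: true :: post ->
    filt (ninv t) (cpsi (size pre).+1 *: stdvec t).
  move=> /down[t' [Et' vt' inv_tt' -> sn]]; set s := (size pre).+1 in sn *.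
  have vt'k : filt (ninv t) (stdvec t') by apply: filt_gen => //; lia.
  have [q Eq hq] := cpsi_quad (rst (stream_of t')) sn.
  move: (weight t' _ _ vt' Eq) vt'k; move: (stdvec t') => v' {}Eq vt'k.
  rewrite scalerA Eq.
  have hy u : (0 < u <= n)%N -> filt (ninv t) (cy u *: v').
    by move=> un; apply: (@filt_le (ninv t).-1); [lia | apply: IHy].
  by case: hq => ->; rewrite ?scale0r ?scale1r ?scalerBl //;
    [exact: filt0 | apply: filtB; apply: (hy); lia | apply: filtB; apply: (hy); lia].
have psi_eq r : (0 < r < n)%N -> nth false t r.-1 = nth false t r ->
    filt (ninv t) (cpsi r *: stdvec t).
  have [[pre [post Et]]|Et0] := validP vt; last first.
    by move=> rn; have [_ _] := spanned_init_tab; rewrite -Et0; apply.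
  have [t' [Et' vt' inv_tt' Ev sn]] := down _ _ Et; set s := (size pre).+1 in sn Ev *.
  move=> rn bits; have bit1 : nth false t s.-1 = false.
    by rewrite Et nth_cat ltnn subnn.
  have bit2 : nth false t s = true.
    by rewrite Et nth_cat ltnNge leqnSn subSn // subnn.
  have [E|rs] := eqVneq r s; first by move: bits; rewrite E bit1 bit2.
  (* Arm leg leg in t comes from leg leg arm in t'' by psi_s psi_{s+1}. The braid relation puts
     psi_s directly before v(t''), where it meets two equal letters and gains nothing. *)
  have [E|rs1] := eqVneq r s.+1.
    have Epost : post = true :: behead post.
      move: bits; rewrite E bit2 Et nth_cat ltnNge (leqW (leqnSn _)) /=.
      by rewrite (_ : s.+1 - size pre = 2)%N /=; [case: (post) => //= x p <- | lia].
    move: Et'; rewrite Epost; set post' := behead post => Et'.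
    set t'' := pre ++ true :: true :: false :: post'.
    have Et1 : t' = (pre ++ [:: true]) ++ false :: true :: post' by rewrite Et' -catA.
    have Et2 : t'' = (pre ++ [:: true]) ++ true :: false :: post' by rewrite -catA.
    have sz : (size (pre ++ [:: true])).+1 = s.+1 by rewrite size_cat addn1.
    have vt'' : valid t'' by rewrite Et2 -valid_swap -Et1.
    have ninv' : ninv t' = (ninv t'').+1 by rewrite Et1 ninv_swap -Et2.
    have Ev' : stdvec t' = cpsi s.+1 *: stdvec t'' by rewrite Et1 stdvec_swap -Et2 sz.
    have sS : (s.+1 < n)%N by lia.
    have s0 : (0 < s)%N by [].
    have e'' : filt (ninv t'') (cpsi s *: stdvec t'').
      by apply: IHe => //; [lia | rewrite !nth_cat ltnn subnn ltnNge leqnSn subSn // subnn].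
    have v''k : filt (ninv t) (stdvec t'') by apply: filt_gen => //; lia.
    have [c Ec] := cpsi_braid (rst (stream_of t'')) s0 sS.
    rewrite Ev Ev' E; move: (weight t'' _ _ vt'' Ec) e'' v''k;
      move: (stdvec t'') => v'' {}Ec e'' v''k.
    have -> : cpsi s.+1 *: (cpsi s *: (cpsi s.+1 *: v'')) =
        cpsi s *: (cpsi s.+1 *: (cpsi s *: v'')) - fscale c v''.
      by apply/eqP; rewrite eq_sym subr_eq /fscale !scalerA Ec scalerDl.
    apply: filtB; last exact: filt_scale.
    by rewrite inv_tt' ninv'; apply: (IHp) => //; [lia | apply: (IHp) => //; lia].
  (* The mirror image: arm arm leg comes from leg arm arm. *)
  have [E|rs2] := eqVneq r.+1 s.
    have [pre' Epre] : exists pre', pre = rcons pre' false.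
      have b : nth false t r.-1 = false by rewrite bits -[r]/(r.+1.-1) E.
      case: (lastP pre) Et b @s E {down bit1 bit2 sn Ev rs rs1 Et'} => [|p x] Et b s E.
        by move: E rn; rewrite /s /= => -[->].
      exists p; congr rcons; move: b; rewrite Et nth_cat size_rcons.
      have -> : r.-1 = size p by move: E; rewrite /s size_rcons => -[->].
      by rewrite ltnSn nth_rcons ltnn eqxx.
    have szp : (size pre').+1 = r by move: E; rewrite /s Epre size_rcons => -[->].
    set t'' := pre' ++ true :: false :: false :: post.
    have Et1 : t' = pre' ++ false :: true :: false :: post by rewrite Et' Epre cat_rcons.
    have vt'' : valid t'' by rewrite -valid_swap -Et1.
    have ninv' : ninv t' = (ninv t'').+1 by rewrite Et1 ninv_swap.
    have Ev' : stdvec t' = cpsi r *: stdvec t'' by rewrite Et1 stdvec_swap szp.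
    have r0 : (0 < r)%N by lia.
    have rS : (r.+1 < n)%N by lia.
    have e'' : filt (ninv t'') (cpsi r.+1 *: stdvec t'').
      apply: IHe => //; first lia.
      by rewrite succnK -szp -addn1 nth_at -addnS nth_at.
    have v''k : filt (ninv t) (stdvec t'') by apply: filt_gen => //; lia.
    have [c Ec] := cpsi_braid (rst (stream_of t'')) r0 rS.
    rewrite Ev Ev' -E; move: (weight t'' _ _ vt'' Ec) e'' v''k;
      move: (stdvec t'') => v'' {}Ec e'' v''k.
    have -> : cpsi r *: (cpsi r.+1 *: (cpsi r *: v'')) =
        cpsi r.+1 *: (cpsi r *: (cpsi r.+1 *: v'')) + fscale c v''.
      by rewrite /fscale !scalerA Ec scalerDl.
    apply: filtD; last exact: filt_scale.
    by rewrite inv_tt' ninv'; apply: (IHp) => //; [lia | apply: (IHp) => //; lia].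
  (* Now psi_r commutes with psi_s, and t and t' agree in the letters r and r + 1. *)
  have bits' : nth false t' r.-1 = nth false t' r.
    have h1 := @nth_swap pre post false true r.-1.
    have h2 := @nth_swap pre post false true r.
    by rewrite Et' -h1 -?h2 -?Et //; rewrite /s in rs rs1 rs2; lia.
  have h := IHe t' r vt' ltac:(lia) rn bits'.
  rewrite Ev; move: (stdvec t') h => v' h.
  rewrite scalerA cpsi_comm; last by lia.
  by rewrite -scalerA inv_tt'; apply: (IHp) => //; lia.
split=> // [r rn|r rn].
  have [[pre [post Et]]|->] := validP vt; last by have [h _ _] := spanned_init_tab;
    apply: h.
  have [t' [Et' vt' inv_tt' Ev sn]] := down _ _ Et; set s := (size pre).+1 in sn Ev *.
  have [|h'y _ _] := IH t' _ vt'; first by lia.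
  have vt'k : filt (ninv t) (stdvec t') by apply: filt_gen => //; lia.
  have E1 := weight t' _ _ vt' (cpsi_cyS (rst (stream_of t')) sn).
  have E2 := weight t' _ _ vt' (cyS_cpsi (rst (stream_of t')) sn).
  rewrite Ev; move: (stdvec t') vt'k h'y E1 E2 => v' vt'k h'y.
  move: (res _ _ == res _ _) => b1 E1 E2.
  have delta (b : bool) : filt (ninv t) (b%:R *: v').
    by case: b; rewrite ?scale1r ?scale0r //; apply: filt0.
  have [->|rs] := eqVneq r s.
    have -> : cy s *: (cpsi s *: v') = cpsi s *: (cy s.+1 *: v') - b1%:R *: v'.
      by apply/eqP; rewrite eq_sym subr_eq !scalerA -scalerDl; apply/eqP.
    by apply: filtB => //; rewrite inv_tt'; apply: (IHp) => //; [lia | apply: (h'y); lia].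
  have [->|rs'] := eqVneq r s.+1.
    rewrite scalerA E2 scalerDl -scalerA.
    by apply: filtD => //; rewrite inv_tt'; apply: (IHp) => //; [lia | apply: (h'y); lia].
  by rewrite scalerA -cpsi_cy // -scalerA inv_tt'; apply: (IHp) => //; [lia | apply: (h'y)].
have [E|ne] := eqVneq (nth false t r.-1) (nth false t r).
  by apply: filt_le (psi_eq r rn E); lia.
(* For distinct letters, leg arm gives another standard vector with one more inversion, and arm leg
   is a descent to which [psi_down] applies. *)
have Et : t = take r.-1 t ++ nth false t r.-1 :: nth false t r :: drop r.+1 t.
  have szt := valid_size vt; rewrite -{1}[t](cat_take_drop r.-1); congr (_ ++ _).
  by rewrite (drop_nth false) ?(drop_nth false (n := r.-1.+1)) prednK //; lia.
have szr : (size (take r.-1 t)).+1 = r by rewrite size_takel ?(valid_size vt); lia.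
case b1: (nth false t r.-1) ne Et => ne Et; case b2: (nth false t r) ne Et => //= _ Et.
  rewrite {2}Et -[in cpsi r]szr -stdvec_swap; apply: filt_gen;
    first by rewrite valid_swap -Et.
  by rewrite ninv_swap -Et.
by rewrite -[in cpsi r]szr; apply: (@filt_le (ninv t)); [lia | apply: psi_down Et].
Qed.

Lemma filt_top x : (exists a, x = a *: z) -> exists k, filt k x.
Proof.
have up_act (c : A) (d : nat -> nat) x' :
    (forall t, valid t -> filt (d (ninv t)) (c *: stdvec t)) ->
    (exists k, filt k x') -> exists k, filt k (c *: x').
  move=> h [k]; elim=> [t vt lt||u v _ [l IHu] _ [l' IHv]|a u _ [l IH]].
  - by exists (d (ninv t)); apply: h.
  - by exists 0%N; rewrite scaler0; apply: filt0.
  - exists (maxn l l'); rewrite scalerDr; apply: filtD.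
      by apply: filt_le IHu; rewrite leq_maxl.
    by apply: filt_le IHv; rewrite leq_maxr.
  - by exists l; rewrite fscaleZ; apply: filt_scale.
case=> c ->; elim/(gcyc_ind (k := g)): c =>
  [|u v [k hu] [l hv]|a u [k hu]|i u hu|r u rn hu|r u rn hu].
- exists (ninv init_tab).+1; rewrite scale1r -stdvec_init_tab; apply: filt_gen => //.
  by rewrite /valid /init_tab size_cat count_cat !size_nseq !count_nseq mul1n mul0n addn0
    subnKC ?eqxx.
- exists (maxn k l); rewrite scalerDl; apply: filtD.
    by apply: filt_le hu; rewrite leq_maxl.
  by apply: filt_le hv; rewrite leq_maxr.
- by exists k; rewrite -scalerA; apply: filt_scale.
- rewrite -scalerA; apply: (up_act _ succn) hu => t vt.
  rewrite -ce_stdvec // scalerA gce_ce; case: eqP => [->|_]; last by rewrite scale0r;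
    apply: filt0.
  by rewrite ce_stdvec //; apply: filt_gen.
- rewrite -scalerA; apply: (up_act _ id) hu => t vt.
  by have [h _ _] := spanP vt; apply: h.
- rewrite -scalerA; apply: (up_act _ (fun k => k.+2)) hu => t vt.
  by have [_ h _] := spanP vt; apply: h.
Qed.

End Spanning.

(** * Moves between words *)

Section Pointwise.
Variable F : fieldType.
Implicit Types (f : stream -> F) (b : stream).

Definition swp3 (k q : nat) : nat :=
  if q == k then k.+2 else if q == k.+2 then k else q.

Lemma scons_swp b k : scons (b 0%N) (stl b \o swp k) = b \o swp k.+1.
Proof. by rewrite -sshift_swp; apply/funext => -[]. Qed.

Lemma scons_swp3 b k : scons (b 0%N) (stl b \o swp3 k) = b \o swp3 k.+1.
Proof.
by apply/funext => -[|q] //=; rewrite /stl /swp3 !eqSS; case: ifP => //; case: ifP.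
Qed.

Lemma off_upE k f b :
  off k (@up F) f b = if ~~ b k && b k.+1 then f (b \o swp k) else 0.
Proof.
elim: k f b => [|k IH] f b.
  rewrite /= /up; case b0: (b 0%N); case b1: (b 1%N) => //=; congr f.
  by apply/funext => -[|[|q]].
by rewrite /= {1}/shift IH scons_swp.
Qed.

Lemma off_downE k f b :
  off k (@down F) f b = if b k && ~~ b k.+1 then f (b \o swp k) else 0.
Proof.
elim: k f b => [|k IH] f b.
  rewrite /= /down; case b0: (b 0%N); case b1: (b 1%N) => //=; congr f.
  by apply/funext => -[|[|q]].
by rewrite /= {1}/shift IH scons_swp.
Qed.

Lemma off_turnE k f b : off k (@turn F) f b =
  if b k && ~~ b k.+2 then (if b k.+1 then f (b \o swp3 k) else - f (b \o swp3 k))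
  else 0.
Proof.
elim: k f b => [|k IH] f b.
  rewrite /= /turn; case b0: (b 0%N); case b1: (b 1%N); case b2: (b 2) => //=.
    by congr f; apply/funext => -[|[|[|q]]].
  by congr (- f _); apply/funext => -[|[|[|q]]].
by rewrite /= {1}/shift IH scons_swp3.
Qed.

Definition ind (b0 b : stream) : F := `[< b = b0 >]%:R.

Lemma ind_neq b0 b k : b k != b0 k -> ind b0 b = 0.
Proof. by move=> h; rewrite /ind asboolF // => E; rewrite E eqxx in h. Qed.

Lemma ind1 b : ind b b = 1.
Proof. by rewrite /ind asboolT. Qed.

Lemma swpL k : swp k k = k.+1.
Proof. by rewrite /swp eqxx. Qed.
Lemma swpR k : swp k k.+1 = k.
Proof. by rewrite /swp eqxx gtn_eqF. Qed.
Lemma swp3L k : swp3 k k = k.+2.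
Proof. by rewrite /swp3 eqxx. Qed.
Lemma swp3R k : swp3 k k.+2 = k.
Proof. by rewrite /swp3 eqxx gtn_eqF // ltnW. Qed.
Lemma swp3M k : swp3 k k.+1 = k.+1.
Proof. by rewrite /swp3 gtn_eqF // ltn_eqF. Qed.

Lemma comp_swpK (b : stream) k : b \o swp k \o swp k = b.
Proof. by apply/funext => q /=; rewrite swpK. Qed.

Lemma nth_at0 (pre s : seq bool) : nth false (pre ++ s) (size pre) = nth false s 0.
Proof. by rewrite -[in LHS](addn0 (size pre)) nth_at. Qed.

Lemma nth_at1 (pre s : seq bool) : nth false (pre ++ s) (size pre).+1 = nth false s 1.
Proof. by rewrite -addn1 nth_at. Qed.

Lemma stream_of_swap pre x y post :
  stream_of (pre ++ x :: y :: post) \o swp (size pre) = stream_of (pre ++ y :: x :: post).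
Proof.
apply/funext => q; rewrite /stream_of /=.
have [->|h1] := eqVneq q (size pre); first by rewrite swpL nth_at0 nth_at1.
have [->|h2] := eqVneq q (size pre).+1; first by rewrite swpR nth_at0 nth_at1.
by rewrite /swp (negPf h1) (negPf h2) nth_swap.
Qed.

Variable e : nat.
Hypothesis e_ge3 : (3 <= e)%N.
Local Notation psi := (@psi_op F e).
Local Notation dot := (@dot_op F e).
Local Notation anchor a := (a%:R = 0 :> 'Z_e).

(** For every r, the terms [turn] and [down] of psi_r never produce arm, leg at r and r + 1, so only
    [up] contributes. *)
Lemma psi_ft r f b : (0 < r)%N -> ~~ b r.-1 -> b r -> psi r f b = f (b \o swp r.-1).
Proof.
case/(psiP F e_ge3) => [|k k0 ak|k k0 ak|k k0 ak|k k0 ka kb kc]; rewrite succnK => b0 b1.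
- by rewrite off_upE b0 b1.
- by rewrite off_upE b0 b1.
- by rewrite /psi1 off_add /oadd -offS off_upE off_turnE b0 b1 andbF addr0.
- by rewrite /psim off_add /oadd off_upE off_turnE b0 b1 (negPf b0) addr0.
- by rewrite /cross off_add /oadd off_upE off_downE b0 b1 (negPf b0) addr0.
Qed.

(** Dual to [psi_ft]: [turn] and [down] never start from a word with leg, arm at r and r + 1, so the
    image is a single word. *)
Lemma psi_ind r b0 : (0 < r)%N -> b0 r.-1 -> ~~ b0 r ->
  psi r (ind b0) = ind (b0 \o swp r.-1).
Proof.
move=> r0 h0 h1; apply/funext => b; have [ft|nft] := boolP (~~ b r.-1 && b r).
  have /andP[b0' b1] := ft; rewrite psi_ft // /ind; congr (nat_of_bool _)%:R.
  by apply: asbool_equiv_eq; split=> [<-|->]; rewrite comp_swpK.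
have -> : ind (b0 \o swp r.-1) b = 0.
  rewrite /ind asboolF // => E; move: nft; rewrite E /= swpL prednK // h1.
  by rewrite -{2}(prednK r0) swpR h0.
case: (psiP F e_ge3 r0) h0 h1 nft => [|k k0 ak|k k0 ak|k k0 ak|k k0 ka kb kc];
  rewrite succnK => h0 h1 nft.
- by rewrite off_upE (negPf nft).
- by rewrite off_upE (negPf nft).
- rewrite /psi1 off_add /oadd -offS off_upE (negPf nft) off_turnE add0r.
  case: ifP => // /andP[bk _].
  by rewrite !(@ind_neq _ _ k.+2) ?oppr0 ?if_same //= swp3R bk (negPf h1).
- rewrite /psim off_add /oadd off_upE (negPf nft) off_turnE add0r.
  case: ifP => // /andP[_ bk].
  by rewrite !(@ind_neq _ _ k) ?oppr0 ?if_same //= swp3L (negPf bk) h0.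
- rewrite /cross off_add /oadd off_upE (negPf nft) off_downE add0r.
  case: ifP => // /andP[_ bk].
  by rewrite !(@ind_neq _ _ k) ?oppr0 ?if_same //= swpL (negPf bk) h0.
Qed.

Section Sorted.
Variable m : nat.
Let b0 : stream := fun q => (q < m)%N.

(** In the sorted word no arm precedes a leg, and both [down] and [turn] need such a pair to
    move. *)
Lemma down_sorted k : off k (@down F) (ind b0) = fun=> 0.
Proof.
apply/funext => b; rewrite off_downE; case: ifP => // /andP[bk bkS].
rewrite /ind asboolF // => E.
have := congr1 (@^~ k) E; have := congr1 (@^~ k.+1) E.
by rewrite /b0 /= swpL swpR bk (negPf bkS); lia.
Qed.

Lemma dot_sorted r : dot r (ind b0) = fun=> 0.
Proof.
case: (posnP r) => [->|/(dotP F e_ge3) []] // k _ _; last exact: down_sorted.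
by apply/funext => b; rewrite /oopp down_sorted oppr0.
Qed.

Lemma turn_sorted k : off k (@turn F) (ind b0) = fun=> 0.
Proof.
apply/funext => b; rewrite off_turnE; case: ifP => // /andP[bk bkS].
have -> : ind b0 (b \o swp3 k) = 0; last by rewrite oppr0 if_same.
rewrite /ind asboolF // => E.
have := congr1 (@^~ k) E; have := congr1 (@^~ k.+2) E.
by rewrite /b0 /= swp3L swp3R bk (negPf bkS); lia.
Qed.

Lemma up_sorted k : k.+1 != m -> off k (@up F) (ind b0) = fun=> 0.
Proof.
move=> km; apply/funext => b; rewrite off_upE; case: ifP => // /andP[bk bkS].
rewrite /ind asboolF // => E.
have := congr1 (@^~ k) E; have := congr1 (@^~ k.+1) E.
by rewrite /b0 /= swpL swpR (negPf bk) bkS; lia.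
Qed.

Lemma psi_sorted r : (0 < r)%N -> r != m -> psi r (ind b0) = fun=> 0.
Proof.
case/(psiP F e_ge3) => [|k k0 ak|k k0 ak|k k0 ak|k k0 ka kb kc] km.
- exact: up_sorted.
- exact: up_sorted.
- by apply/funext => b; rewrite /psi1 off_add /oadd -offS up_sorted // turn_sorted addr0.
- by apply/funext => b; rewrite /psim off_add /oadd up_sorted // turn_sorted addr0.
- by apply/funext => b; rewrite /cross off_add /oadd up_sorted // down_sorted addr0.
Qed.
End Sorted.

(* The words with first letter arm span a submodule. *)
Definition armfirst f := forall b, b 0%N -> f b = 0.

Lemma armfirst_shift O f : lin O -> armfirst f -> armfirst (shift O f).
Proof.
move=> hO hf b b0; rewrite /shift [X in O X](_ : _ = fun=> 0) ?lin0 //.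
by apply/funext => w; apply: hf.
Qed.

Lemma armfirst_off k O f : (0 < k)%N -> lin O -> armfirst f -> armfirst (off k O f).
Proof. by case: k => // k _ hO; apply: armfirst_shift; apply: lin_off. Qed.

(** psi_1 acts by [up], which only produces words starting with arm; the window of every other psi_r
    starts after the first letter. *)
Lemma armfirst_psi r f : (0 < r)%N -> armfirst f -> armfirst (psi r f).
Proof.
case/(psiP F e_ge3) => [|k k0 ak|k k0 ak|k k0 ak|k k0 ka kb kc].
- by move=> _ b b0; rewrite off_upE b0.
- exact/armfirst_off/lin_up.
- exact/armfirst_off/lin_psi1.
- exact/armfirst_off/lin_psim.
- exact/armfirst_off/lin_cross.
Qed.

Lemma armfirst_dot r f : (0 < r)%N -> armfirst f -> armfirst (dot r f).
Proof.
case/(dotP F e_ge3) => [//|k k0 _|k k0 _] hf.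
- by move=> b b0; rewrite /oopp (armfirst_off k0 (@lin_down F) hf) ?oppr0.
- exact: (armfirst_off k0 (@lin_down F) hf).
Qed.

Lemma window_eq (b c : stream) k : b k = c k -> b k.+1 = c k.+1 -> b k.+2 = c k.+2 ->
  (forall q, q != k -> q != k.+1 -> q != k.+2 -> b q = c q) -> b = c.
Proof.
move=> h0 h1 h2 h; apply/funext => q.
have [->|n0] := eqVneq q k; first exact: h0.
have [->|n1] := eqVneq q k.+1; first exact: h1.
have [->|n2] := eqVneq q k.+2; first exact: h2.
exact: h.
Qed.

Lemma swp_out k q : q != k -> q != k.+1 -> swp k q = q.
Proof. by rewrite /swp => /negPf-> /negPf->. Qed.
Lemma swp3_out k q : q != k -> q != k.+2 -> swp3 k q = q.
Proof. by rewrite /swp3 => /negPf-> /negPf->. Qed.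

Lemma swp_lt k : swp k.+1 k = k.
Proof. by rewrite swp_out // ltn_eqF // ltnW. Qed.
Lemma swp_gt k : swp k k.+2 = k.+2.
Proof. by rewrite swp_out // gtn_eqF // ltnW. Qed.

Definition swpE := (swpL, swpR, swp3L, swp3R, swp3M, swp_lt, swp_gt).

Ltac window k := apply: (@window_eq _ _ k) => [|||q n0 n1 n2] /=;
  rewrite ?swpE ?swp3_out ?swp_out ?swp3_out //.

(* The move at position r from an (arm, leg) to a (leg, arm) pair is always   *)
(* induced by psi_r; if r > 1 then its inverse is induced by one of the       *)
(* following operators, up to a sign.                                         *)
Inductive undo (r : nat) (b : stream) : Prop :=
| UndoPsi of forall f, psi r f b = f (b \o swp r.-1)
| UndoDot of forall f, dot r f b = - f (b \o swp r.-1)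
| UndoPsiL of forall f, psi r (psi r.-1 f) b = f (b \o swp r.-1)
| UndoLPsi of forall f, psi r.-1 (psi r f) b = - f (b \o swp r.-1)
| UndoPsiR of anchor r.+1 & forall f, psi r (psi r.+1 f) b = - f (b \o swp r.-1)
| UndoRPsi of anchor r.+1 & forall f, psi r.+1 (psi r f) b = f (b \o swp r.-1).

(** If e | r, -y_r makes the move; if r is not 0, 1 or -1 modulo e, [cross] does. Otherwise a [turn]
    over three letters is combined with the neighbouring psi, and the third letter of the window
    decides their order. *)
Lemma undoP r b : (1 < r)%N -> b r.-1 -> ~~ b r -> undo r b.
Proof.
move=> r1 b0 b1; have r0 : (0 < r)%N by lia.
have psi1E k f c : off k (@psi1 F) f c = off k.+1 (@up F) f c + off k (@turn F) f c.
  by rewrite /psi1 off_add -offS.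
have psimE k f c : off k (@psim F) f c = off k (@up F) f c + off k (@turn F) f c.
  by rewrite /psim off_add.
have := psiP F e_ge3 r0; move def_p: (psi r) => p; move def_d: (dot r) => d;
  move: (dot r.+1) => dS h.
case: h def_p def_d r1 b0 b1 {r0} =>
  [|k k0 ak|k k0 ak|k k0 ak|k k0 ka kb kc] def_p def_d r1;
  rewrite ?succnK => b0 b1 //.
- by apply: UndoDot => f; rewrite def_d /oopp off_downE b0 b1.
- case b2: (b k).
    apply: UndoPsiL => f; rewrite succnK def_p psi1E off_upE b0 andFb add0r off_turnE b2
      b1 b0 /=.
    rewrite psi_ft ?succnK //= ?swpE ?b2 //.
    by congr f; window k; rewrite ?b0 ?b2.
  apply: UndoLPsi => f; rewrite succnK psi_ft ?succnK ?b2 // def_p psi1E off_upE /= ?swpE.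
  rewrite b2 (negPf b1) add0r off_turnE /= ?swpE b0 b1 b2 /=.
  by congr (- f _); window k; rewrite ?b0 ?b2 ?(negPf b1).
- have ak' : anchor k.+2 by [].
  case b2: (b k.+2).
    apply: UndoRPsi => // f; rewrite psi_ft //= def_p psimE off_upE /= ?swpE.
    rewrite b0 b2 add0r off_turnE /= ?swpE b0 b1 b2 /=.
    by congr f; window k; rewrite ?b0 ?b2 ?(negPf b1).
  apply: UndoPsiR => // f; rewrite def_p psimE off_upE b0 /= add0r off_turnE b0 b2 (negPf
    b1) /=.
  rewrite psi_ft ?succnK //= ?swpE ?b1 ?b0 //.
  by congr (- f _); window k; rewrite ?b0 ?b2 ?(negPf b1).
- apply: UndoPsi => f; rewrite def_p /cross off_add /oadd off_upE off_downE b0 b1 /=.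
  by rewrite add0r.
Qed.

Lemma off_up_down k : ocomp (off k (@up F)) (off k (@down F)) =
  diag (fun b => (~~ b k && b k.+1)%:R).
Proof.
apply: oeqP => f b; rewrite /ocomp /diag off_upE off_downE /= ?swpE comp_swpK.
by case: (b k) (b k.+1) => -[]; rewrite /= ?mul0r ?mul1r.
Qed.

Lemma off_down_up k : ocomp (off k (@down F)) (off k (@up F)) =
  diag (fun b => (b k && ~~ b k.+1)%:R).
Proof.
apply: oeqP => f b; rewrite /ocomp /diag off_downE off_upE /= ?swpE comp_swpK.
by case: (b k) (b k.+1) => -[]; rewrite /= ?mul0r ?mul1r.
Qed.

Lemma anchor_ops k : (0 < k)%N -> anchor k.+1 ->
  psi k.+1 = off k (@up F) /\ dot k.+1 = oopp (off k (@down F)).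
Proof.
case: k => // k _ ak; rewrite /psi_op /dot_op /= ak eqxx //.
Qed.

End Pointwise.

(** * Submodules are spanned by standard basis elements *)

Section Decomposition.
Variables (F : fieldType) (e n : nat) (A : pzAlgType F) (g : klr_family e n A).
Hypothesis e_ge3 : (3 <= e)%N.
Hypothesis n_anchor : n%:R != 0 :> 'Z_e.
Local Notation ce := (gce g).
Local Notation cy := (gcy g).
Local Notation cpsi := (gcpsi g).
Local Notation psi := (@psi_op F e).
Local Notation dot := (@dot_op F e).
Local Notation anchor a := (a%:R = 0 :> 'Z_e).
Variables (K : 'Z_e) (m : nat).
Hypothesis m_gt0 : (0 < m)%N.
Hypothesis m_lt_n : (m < n)%N.
Local Notation rst b := (mkres n (rsd K 1 b)).
Local Notation init_tab := (init_tab n m).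
Local Notation valid := (valid n m).

Variables (S : lmodType A) (z : S).
Hypothesis ce_z : ce (rst (stream_of init_tab)) *: z = z.
Hypothesis cy_z : forall r, (0 < r <= n)%N -> cy r *: z = 0.
Hypothesis cpsi_z : forall r, (0 < r < n)%N -> r != m -> cpsi r *: z = 0.
Hypothesis z_gen : forall x, exists a, x = a *: z.
Local Notation stdvec := (stdvec g z).

Variable rho : action stream A.
Hypothesis rho_e : forall i, rho (ce i) = @proj F e n K i.
Hypothesis rho_y : forall r, (0 < r <= n)%N -> rho (cy r) = dot r.
Hypothesis rho_psi : forall r, (0 < r < n)%N -> rho (cpsi r) = psi r.

Variable phi : S -> stream -> F.
Hypothesis phi_z : phi z = ind F (stream_of init_tab).
Hypothesis phiZ : forall a x, phi (a *: x) = rho a (phi x).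
Hypothesis phiD : forall x y b, phi (x + y) b = phi x b + phi y b.

Let m_le_n : (m <= n)%N := ltnW m_lt_n.

Lemma phi0 b : phi 0 b = 0.
Proof. by rewrite -(scale0r z) phiZ act0. Qed.

Lemma stream_of_inj t u : size t = size u -> stream_of t = stream_of u -> t = u.
Proof.
move=> sz E; apply: (@eq_from_nth _ false) => // q _.
exact: (congr1 (@^~ q) E).
Qed.

Lemma phi_stdvec t : valid t -> phi (stdvec t) = ind F (stream_of t).
Proof.
have [k] := ubnP (ninv t); elim: k t => // k IH t; rewrite ltnS => inv_t vt.
have [[pre [post Et]]|->] := validP vt; last by rewrite stdvec_init_tab.
move: vt inv_t; rewrite Et valid_swap ninv_swap => vt inv_t.
have sz : ((size pre).+1 < n)%N by rewrite -(valid_size vt) size_cat /=; lia.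
rewrite (stdvec_swap g m_le_n) phiZ rho_psi // IH // psi_ind //.
- by rewrite succnK stream_of_swap.
- by rewrite succnK /stream_of nth_at0.
- by rewrite /stream_of nth_at1.
Qed.

(** The standard vectors span, and [phi] takes each of them to an indicator, so it reads off
    coefficients. *)
Lemma reconstruct x :
  x = \sum_(u : n.-tuple bool | valid u) fscale (phi x (stream_of u)) (stdvec u).
Proof.
have [k] := filt_top m_le_n ce_z cy_z cpsi_z (z_gen x).
have fscaleD a b y : fscale (a + b) y = fscale a y + fscale b y :> S.
  by rewrite /fscale (rmorphD (Defs.scalar : {rmorphism F -> A})) scalerDl.
have fscale0 y : fscale 0 y = 0 :> S.
  by rewrite /fscale (rmorph0 (Defs.scalar : {rmorphism F -> A})) scale0r.
elim=> [t vt _||u v _ IHu _ IHv|a u _ IH].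
- have szt : size t == n by rewrite (valid_size vt).
  rewrite (bigD1 (Tuple szt)) //= phi_stdvec // ind1 big1 ?addr0.
    by rewrite /fscale (rmorph1 (Defs.scalar : {rmorphism F -> A})) scale1r.
  move=> u /andP[vu ut]; rewrite /ind asboolF ?fscale0 // => E.
  move/eqP: ut; apply; apply: val_inj; apply: stream_of_inj E.
  by rewrite /= size_tuple (eqP szt).
- by rewrite big1 // => u _; rewrite phi0 fscale0.
- rewrite {1}IHu {1}IHv -big_split; apply: eq_bigr => w _ /=.
  by rewrite phiD fscaleD.
- rewrite {1}IH /fscale scaler_sumr; apply: eq_bigr => w _.
  by rewrite phiZ act_scalar scalerA -(rmorphM (Defs.scalar : {rmorphism F -> A})).
Qed.

Definition generates (x y : S) := exists c : A, y = c *: x.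

Lemma gen_trans x y w : generates x y -> generates y w -> generates x w.
Proof. by move=> [c ->] [d ->]; exists (d * c); rewrite scalerA. Qed.

Lemma phi_inj x : (forall t, valid t -> phi x (stream_of t) = 0) -> x = 0.
Proof.
move=> h; rewrite [x]reconstruct big1 // => u vu; rewrite h //.
by rewrite /fscale (rmorph0 (Defs.scalar : {rmorphism F -> A})) scale0r.
Qed.

Lemma first_difference (t u : seq bool) : size t = size u -> t != u ->
  exists pre x s s', t = pre ++ x :: s /\ u = pre ++ ~~ x :: s'.
Proof.
elim: t u => [|x t IH] [|y u] //= [sz] ne; have [E|xy] := eqVneq x y.
  move: ne; rewrite E eqseq_cons eqxx /= => /IH[] // pre [x' [s [s' [-> ->]]]].
  by exists (y :: pre), x', s, s'.
by exists [::], x, t, u; split=> //=; congr cons; case: x y xy {ne} => -[].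
Qed.

Definition separates (c : A) (t u : seq bool) := exists d : stream -> F,
  [/\ rho c = diag d, d (stream_of t) = 1 & d (stream_of u) = 0].

Lemma separate t u : valid t -> valid u -> t != u -> exists c, separates c t u.
Proof.
move=> vt vu tu; have [E|ne] := eqVneq (rst (stream_of t)) (rst (stream_of u)); last first.
  exists (ce (rst (stream_of t))); exists (fun b => (rst b == rst (stream_of t))%:R).
  by rewrite rho_e eqxx eq_sym (negPf ne).
have szt := valid_size vt; have szu := valid_size vu.
have [|pre [x [s [s' [Et Eu]]]]] := first_difference _ tu; first by rewrite szt.
set k := size pre.
have kn : (k < n)%N by rewrite -szt Et size_cat /=; lia.
have Er q : (q < n)%N -> rsd K 1 (stream_of t) q = rsd K 1 (stream_of u) q.
  by move=> qn; rewrite -(mkresE (n := n) (rsd K 1 (stream_of t)) qn) E mkresE.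
have tk : stream_of t k = x by rewrite Et /stream_of nth_at0.
have uk : stream_of u k = ~~ x by rewrite Eu /stream_of nth_at0.
(* After equal prefixes, a leg and an arm in the same place have equal residues only at a multiple
   of e. *)
have ak : anchor k.+1.
  have := Er _ kn; rewrite !rsdE tk uk nat1r.
  have -> : (\sum_(i < k) stream_of t i = \sum_(i < k) stream_of u i)%N.
    by apply: eq_bigr => i _; rewrite Et Eu /stream_of !nth_cat ltn_ord.
  by move/addrI; case: (x) => /=.
(* This is where e not dividing n is needed: there is a further letter to compare. *)
have kn' : (k.+1 < n)%N.
  by rewrite ltn_neqAle kn andbT; apply/eqP => kn'; move: n_anchor; rewrite -kn' ak eqxx.
have k0 : (0 < k)%N by rewrite -ltnS; apply: leq_trans (anchor_ge3 e_ge3 ak isT).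
have [psi_k dot_k] := anchor_ops F k0 ak.
have := Er _ kn'; rewrite !rs_step (Er _ kn) ak tk uk => /addrI Es.
(* With residue difference 0, leg can be followed by a step -1 or 0, and arm by 0 or 1. Equality
   forces the step 0, that is, distinct letters in both words. *)
have [txt uxu] : stream_of t k.+1 = ~~ x /\ stream_of u k.+1 = x.
  have f1 : (1 == 0 :> 'Z_e) = false by apply/negbTE/oneI_neq0.
  have f2 : (1 == -1 :> 'Z_e) = false by apply/negbTE/one_neqN1.
  have f3 : (-1 == 0 :> 'Z_e) = false by rewrite oppr_eq0.
  move/eqP: Es.
  by case: x {tk uk Et Eu} (stream_of t k.+1) (stream_of u k.+1) => -[] [] /=;
     rewrite ?oppr0 ?f1 ?f2 ?f3 // eq_sym ?f1 ?f2 ?f3.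
have rn : (0 < k.+1 < n)%N by [].
have rn' : (0 < k.+1 <= n)%N by lia.
case: x tk uk txt uxu {Et Eu Es} => tk uk txt uxu.
  exists (- (cy k.+1 * cpsi k.+1)), (fun b => (b k && ~~ b k.+1)%:R).
  rewrite tk uk txt uxu; split=> //; rewrite -off_down_up.
  apply/funext => f; apply/funext => b.
  by rewrite actN actM rho_psi // rho_y // psi_k dot_k /oopp opprK.
exists (- (cpsi k.+1 * cy k.+1)), (fun b => (~~ b k && b k.+1)%:R).
rewrite tk uk txt uxu; split=> //; rewrite -off_up_down.
apply/funext => f; apply/funext => b.
rewrite actN actM rho_psi // rho_y // psi_k dot_k /oopp /ocomp.
by rewrite linN ?opprK //; apply/lin_off/lin_up.
Qed.

Lemma separate_all t (l : seq (seq bool)) : valid t ->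
  exists (c : A) (d : stream -> F), [/\ rho c = diag d, d (stream_of t) = 1 &
    forall u, u \in l -> valid u -> u != t -> d (stream_of u) = 0].
Proof.
move=> vt; elim: l => [|u l [c [d [rc dt dl]]]].
  exists 1, (fun=> 1); split=> //; apply/funext => f.
  by rewrite act1; apply/funext => b; rewrite /diag mul1r.
have [/andP[vu ut]|h] := boolP (valid u && (u != t)); last first.
  exists c, d; split=> // w; rewrite inE => /predU1P[-> vu ut|]; last exact: dl.
  by rewrite vu ut in h.
have [|c' [d' [rc' dt' du']]] := separate vt vu; first by rewrite eq_sym.
exists (c' * c), (fun b => d' b * d b); split.
- apply/funext => f; rewrite actM rc rc'; apply/funext => b.
  by rewrite /diag mulrA.
- by rewrite dt dt' mulr1.
- move=> w; rewrite inE => /predU1P[-> _ _|wl vw wt]; first by rewrite du' mul0r.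
  by rewrite dl // mulr0.
Qed.

(** A product of separating elements keeps only the component of x at t, and the scalar normalises
    it. *)
Lemma gen_stdvec x t : valid t -> phi x (stream_of t) != 0 -> generates x (stdvec t).
Proof.
move=> vt xt; have [c [d [rc dt dl]]] := separate_all [seq val u | u : n.-tuple bool] vt.
exists (Defs.scalar (phi x (stream_of t))^-1 * c); rewrite -scalerA.
have szt : size t == n by rewrite (valid_size vt).
rewrite [c *: x]reconstruct (bigD1 (Tuple szt)) //= big1 ?addr0.
  rewrite /fscale scalerA -(rmorphM (Defs.scalar : {rmorphism F ->
    A})) phiZ rc /diag dt mul1r mulVf //.
  by rewrite (rmorph1 (Defs.scalar : {rmorphism F -> A})) scale1r.
move=> u /andP[vu ut]; rewrite phiZ rc /diag dl ?mul0r //.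
- by rewrite /fscale (rmorph0 (Defs.scalar : {rmorphism F -> A})) scale0r.
- by apply/imageP; exists u.
Qed.

(** Only the coefficient at u has to be controlled: [gen_stdvec] removes all other terms of c
    v(t). *)
Lemma gen_move t u c (a : F) : valid t -> valid u -> a != 0 ->
  (forall f, rho c f (stream_of u) = a * f (stream_of t)) ->
    generates (stdvec t) (stdvec u).
Proof.
move=> vt vu a0 h; apply: (gen_trans (y := c *: stdvec t)); first by exists c.
by apply: gen_stdvec => //; rewrite phiZ h phi_stdvec // ind1 mulr1.
Qed.

Lemma gen_swap pre x y post : (0 < size pre)%N -> valid (pre ++ x :: y :: post) ->
  generates (stdvec (pre ++ x :: y :: post)) (stdvec (pre ++ y :: x :: post)).
Proof.
move=> pre0 vt.
have vu : valid (pre ++ y :: x :: post).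
  by move: vt; rewrite /valid !size_cat !count_cat /= (addnCA x).
have [->|] := eqVneq x y; first by exists 1; rewrite scale1r.
have szt := valid_size vt; pose r := (size pre).+1.
have rn : (0 < r < n)%N by rewrite -szt size_cat /=; lia.
have rn' : (0 < r <= n)%N by lia.
have Eb := stream_of_swap pre y x post; rewrite -[size pre]/(r.-1) in Eb.
have u0 : stream_of (pre ++ y :: x :: post) r.-1 = y by rewrite /stream_of nth_at0.
have u1 : stream_of (pre ++ y :: x :: post) r = x by rewrite /stream_of nth_at1.
move: (pre ++ x :: y :: post) (pre ++ y :: x :: post) vt vu Eb u0 u1 {szt} => t u vt vu Eb.
case: x y => -[] u0 u1 // _.
  apply: (@gen_move t u (cpsi r) 1) => //; first exact: oner_neq0.
  by move=> f; rewrite rho_psi // mul1r psi_ft ?u0 ?u1 ?Eb.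
have N1 : -1 != 0 :> F by rewrite oppr_eq0 oner_neq0.
have r1 : (1 < r)%N by [].
(* Undoing a move may need psi_{r+1}, hence r + 1 < n; equality would make n a multiple of e. *)
have anchor_lt : anchor r.+1 -> (0 < r.+1 < n)%N.
  move=> ar; rewrite /= ltn_neqAle; case/andP: rn => _ ->; rewrite andbT.
  by apply/eqP => rn1; move: n_anchor; rewrite -rn1 ar eqxx.
have rp : (0 < r.-1 < n)%N by lia.
have := @undoP F e e_ge3 r (stream_of u) r1;
  rewrite u0 u1 => /(_ isT isT) [h|h|h|h|/anchor_lt ar h|/anchor_lt ar h].
- apply: (@gen_move t u (cpsi r) 1) => // [|f]; first exact: oner_neq0.
  by rewrite rho_psi // h Eb mul1r.
- apply: (@gen_move t u (cy r) (-1)) => // f.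
  by rewrite rho_y // h Eb mulN1r.
- apply: (@gen_move t u (cpsi r * cpsi r.-1) 1) => // [|f]; first exact: oner_neq0.
  by rewrite actM !rho_psi // h Eb mul1r.
- apply: (@gen_move t u (cpsi r.-1 * cpsi r) (-1)) => // f.
  by rewrite actM !rho_psi // h Eb mulN1r.
- apply: (@gen_move t u (cpsi r * cpsi r.+1) (-1)) => // f.
  by rewrite actM !rho_psi // h Eb mulN1r.
- apply: (@gen_move t u (cpsi r.+1 * cpsi r) 1) => // [|f]; first exact: oner_neq0.
  by rewrite actM !rho_psi // h Eb mul1r.
Qed.

Lemma valid_perm t u : perm_eq t u -> valid t = valid u.
Proof. by move=> p; rewrite /valid (perm_size p) (permP p). Qed.

Lemma gen_perm pre s s' : (0 < size pre)%N -> perm_eq s s' -> valid (pre ++ s) ->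
  generates (stdvec (pre ++ s)) (stdvec (pre ++ s')).
Proof.
elim: s pre s' => [|x s IH] pre s' pre0.
  by rewrite perm_sym => /perm_nilP -> _; exists 1; rewrite scale1r.
move=> p v; have xs' : x \in s' by rewrite -(perm_mem p) inE eqxx.
case: (splitPr xs') p => s1 s2 p.
have ps : perm_eq s (s1 ++ s2).
  by rewrite -(perm_cons x); apply: (perm_trans p); rewrite (perm_catCA s1 [:: x] s2).
have v' : valid (pre ++ x :: s1 ++ s2).
  by rewrite -(valid_perm (t := pre ++ x :: s)) // perm_cat2l perm_cons.
apply: (gen_trans (y := stdvec (pre ++ x :: s1 ++ s2))).
  have := IH (rcons pre x) (s1 ++ s2); rewrite !cat_rcons size_rcons; exact.
(* The letter x travels to the right across s1 by adjacent exchanges. *)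
elim: s1 pre pre0 v' {p ps v xs' IH} => [|y s1 IH] pre pre0 v'; first by exists 1;
  rewrite scale1r.
apply: gen_trans (gen_swap pre0 v') _.
have := IH (rcons pre y); rewrite !cat_rcons size_rcons; apply=> //.
rewrite -(valid_perm (t := pre ++ x :: (y :: s1) ++ s2)) //.
by rewrite perm_cat2l (perm_catCA [:: x] [:: y]).
Qed.

Lemma perm_bool (s : seq bool) :
  perm_eq s (nseq (count id s) true ++ nseq (size s - count id s) false).
Proof.
elim: s => // -[] s IH; first by rewrite /= perm_cons.
rewrite /= add0n subSn ?count_size // perm_sym /= (perm_catCA _ [:: false]) /=.
by rewrite perm_cons perm_sym.
Qed.

Lemma gen_head x s s' : valid (x :: s) -> valid (x :: s') ->
  generates (stdvec (x :: s)) (stdvec (x :: s')).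
Proof.
move=> v v'; apply: (@gen_perm [:: x]) => //.
apply: (perm_trans (perm_bool s)); rewrite perm_sym; apply: (perm_trans (perm_bool s')).
case/andP: v => /eqP h1 /eqP h2; case/andP: v' => /eqP h3 /eqP h4.
have -> : size s' = size s by move: h1 h3 => /=; lia.
by have -> : count id s' = count id s by move: h2 h4 => /=; lia.
Qed.

(** The tableau of v(2, ..., m + 1), the generator of the image of chi. *)
Definition image_tab : seq bool := false :: nseq m true ++ nseq (n - m).-1 false.

Lemma valid_image_tab : valid image_tab.
Proof.
by rewrite /valid /= size_cat count_cat !size_nseq !count_nseq; apply/andP; split;
  apply/eqP; lia.
Qed.

Lemma valid_init_tab : valid init_tab.
Proof.
by rewrite /valid size_cat count_cat !size_nseq !count_nseq; apply/andP; split;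
  apply/eqP; lia.
Qed.

Lemma init_tab_head : init_tab = true :: behead init_tab.
Proof. by rewrite /init_tab; case: (m) m_gt0. Qed.

Lemma armfirst_act c f : armfirst f -> armfirst (rho c f).
Proof.
elim/(gcyc_ind (k := g)): c f => [|x y IHx IHy|a x IH|i x IH|r x rn IH|r x rn IH] f hf.
- by rewrite act1.
- by move=> b b0; rewrite actD IHx // IHy // addr0.
- by move=> b b0; rewrite actM act_scalar IH // mulr0.
- by move=> b b0; rewrite actM rho_e /proj /diag IH // mulr0.
- by rewrite actM rho_y //; apply: armfirst_dot => //; [lia | apply: IH].
- by rewrite actM rho_psi //; apply: armfirst_psi => //; [lia | apply: IH].
Qed.

Lemma armfirst_gen x : generates (stdvec image_tab) x -> armfirst (phi x).
Proof.
case=> a ->; rewrite phiZ; apply: armfirst_act; rewrite phi_stdvec ?valid_image_tab //.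
by move=> b b0; apply: (@ind_neq _ _ _ 0%N); rewrite b0.
Qed.

Lemma stdvec_image_tab_neq0 : stdvec image_tab != 0.
Proof.
apply/eqP => E; have := phi_stdvec valid_image_tab;
  rewrite E => /(congr1 (@^~ (stream_of image_tab))).
by rewrite ind1 phi0 => /eqP; rewrite eq_sym oner_eq0.
Qed.

(** All words in the support of x start with arm, so x yields some v(t) with first letter arm, and
    this yields all others. *)
Lemma gen_image_irr x : generates (stdvec image_tab) x -> x != 0 ->
  generates x (stdvec image_tab).
Proof.
move=> wx x0; have [t vt xt] : exists2 t, valid t & phi x (stream_of t) != 0.
  apply: contrapT => h; case/eqP: x0; apply: phi_inj => t vt.
  by have [//|xt] := eqVneq (phi x (stream_of t)) 0; case: h; exists t.
apply: (gen_trans (gen_stdvec vt xt)).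
case: t vt xt => [|[] s] vt xt.
- by move: (valid_size vt) => /=; lia.
- by rewrite (armfirst_gen wx) ?eqxx in xt.
- exact: gen_head valid_image_tab.
Qed.

Lemma z_notin_image : ~ generates (stdvec image_tab) z.
Proof.
move=> /armfirst_gen h; have := h (stream_of init_tab); rewrite init_tab_head => /(_ isT).
by rewrite -init_tab_head phi_z ind1 => /eqP; rewrite oner_eq0.
Qed.

(** If no word in the support of x started with leg, x would lie in the image. So x yields some v(t)
    with first letter leg, and then z, whose tableau starts with leg since m > 0. *)
Lemma gen_quotient_irr x : ~ generates (stdvec image_tab) x -> generates x z.
Proof.
move=> wx; have [t /andP[vt ht] xt] : exists2 t, valid t && stream_of t 0%N & phi x
  (stream_of t) != 0.
  apply: contrapT => h; apply: wx; rewrite [x]reconstruct.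
  have gen0 : generates (stdvec image_tab) 0 by exists 0; rewrite scale0r.
  apply: (big_ind (generates (stdvec image_tab))) => // [y y' [a ->] [b ->]|u vu].
    by exists (a + b); rewrite scalerDl.
  have [->|xu] := eqVneq (phi x (stream_of u)) 0.
    by rewrite /fscale (rmorph0 (Defs.scalar : {rmorphism F -> A})) scale0r.
  apply: (gen_trans (y := stdvec u)); last by exists (Defs.scalar (phi x (stream_of u))).
  case: (tval u) vu xu => [|[] s] vu xu.
  - by move: (valid_size vu) => /=; lia.
  - by case: h; exists (true :: s) => //; rewrite vu.
  - exact: gen_head valid_image_tab vu.
apply: (gen_trans (gen_stdvec vt xt)).
have E : stdvec (true :: behead init_tab) = z by rewrite -init_tab_head stdvec_init_tab.
rewrite -[X in generates _ X]E.
case: t vt ht xt => [|[] s] vt // _ _.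
by apply: gen_head => //; rewrite -init_tab_head valid_init_tab.
Qed.

End Decomposition.

(** * The concrete algebra and Specht module as instances *)

Lemma cyc_quad (F : fieldType) (e n : nat) (k1 k2 : 'Z_e) r i : (0 < r < n)%N ->
  exists2 q, cpsi F n k1 k2 r * cpsi F n k1 k2 r * ce F k1 k2 i = q * ce F k1 k2 i &
  [\/ q = 0, q = cy F n k1 k2 r.+1 - cy F n k1 k2 r,
      q = cy F n k1 k2 r - cy F n k1 k2 r.+1 | q = 1].
Proof.
move=> rn; exists (cyc_pi k1 k2 (fquad F r i)); first exact: cpsi_quad.
rewrite /fquad; case: ifP => _; first by constructor 1; rewrite cyc_pi0.
case: ifP => _; first by constructor 2; rewrite cyc_piD cyc_piN.
case: ifP => _; first by constructor 3; rewrite cyc_piD cyc_piN.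
by constructor 4; rewrite cyc_pi1.
Qed.

Lemma cyc_braid (F : fieldType) (e n : nat) (k1 k2 : 'Z_e) r i : (0 < r)%N ->
  (r.+1 < n)%N ->
  exists c : F, cpsi F n k1 k2 r * cpsi F n k1 k2 r.+1 * cpsi F n k1 k2 r * ce F k1 k2 i =
  (cpsi F n k1 k2 r.+1 * cpsi F n k1 k2 r * cpsi F n k1 k2 r.+1 + Defs.scalar c)
    * ce F k1 k2 i.
Proof.
move=> r0 rn; have E := cpsi_braid F k1 k2 i r0 rn.
suff [c Ec] : exists c : F, cyc_pi k1 k2 (fbraid F r i) = Defs.scalar c.
  by exists c; rewrite Ec in E.
rewrite /fbraid; case: ifP => _.
  by exists 1; rewrite cyc_pi1 (rmorph1 (Defs.scalar : {rmorphism F -> cyc F n k1 k2})).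
case: ifP => _.
  by exists (-1); rewrite cyc_piN cyc_pi1 (rmorphN1 (Defs.scalar : {rmorphism F ->
    cyc F n k1 k2})).
by exists 0; rewrite cyc_pi0 (rmorph0 (Defs.scalar : {rmorphism F -> cyc F n k1 k2})).
Qed.

Lemma cyc_ce_ce (F : fieldType) (e n : nat) (k1 k2 : 'Z_e) (i j : n.-tuple 'Z_e) :
  ce F k1 k2 i * ce F k1 k2 j = if i == j then ce F k1 k2 i else 0.
Proof.
have := cyc_pi_rel k1 k2 (klr_ee F i j); case: ifP => _.
  by move=> E; rewrite -[RHS]E; apply/esym/cyc_piM.
by rewrite cyc_pi0 => <-; apply/esym/cyc_piM.
Qed.

Definition cyc_family (F : fieldType) (e n : nat) (k1 k2 : 'Z_e) :
    klr_family e n (cyc F n k1 k2) :=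
  @KlrFamily F e n (cyc F n k1 k2) (ce F k1 k2) (cy F n k1 k2) (cpsi F n k1 k2)
    (@cyc_ce_ce F e n k1 k2) (@cpsi_comm F e n k1 k2) (@cpsi_ce F e n k1 k2)
    (@cpsi_cy F e n k1 k2) (@cpsi_cyS F e n k1 k2) (@cyS_cpsi F e n k1 k2)
    (@cyc_quad F e n k1 k2) (@cyc_braid F e n k1 k2) (@cyc_ind F e n k1 k2).

Lemma tab_op_shift (F : fieldType) (e n : nat) (A : pzAlgType F) (g : klr_family e n A)
  a s p :
  tab_op g (nseq a true ++ nseq s false) p.+1 p = \prod_(p <= j < p + a) gpsi_down g j.+1 j.
Proof.
elim: a p => [|a IH] p.
  rewrite addn0 big_geq //=.
  by elim: s {1}p.+1 => //= s IH q; rewrite IH.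
by rewrite big_ltn; [rewrite /= IH addSnnS | lia].
Qed.

Section Hook.
Variables (F : fieldType) (e n : nat).
Hypothesis e_ge3 : (3 <= e)%N.
Hypothesis n_gt0 : (0 < n)%N.
Variables (K : 'Z_e) (m : nat).
Hypothesis m_le_n : (m <= n)%N.
Local Notation A := (cyc F n (K + 1) K).
Local Notation S := (specht_hook2 F n (K + 1) K m).
Local Notation z := (z_hook2 F n (K + 1) K m).
Local Notation rst b := (mkres n (rsd K 1 b)).
Local Notation ca := (@cyc_action F e n e_ge3 K n_gt0).

Lemma rst_init_tab : rst (stream_of (init_tab n m)) = res_hook2 n (K + 1) K m.
Proof.
apply: eq_from_tnth => k; rewrite !tnth_mktuple rsdE stream_of_init_tab.
have -> q : (\sum_(i < q) stream_of (init_tab n m) i = minn q m)%N.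
  elim: q => [|q IH]; first by rewrite big_ord0 min0n.
  by rewrite big_ord_recr IH /= stream_of_init_tab; case: ltnP; lia.
case: ltnP => km; first by rewrite addr0.
rewrite natrB //; ring.
Qed.

(** The indicator of the sorted word obeys the relations of z, which is what makes [phi] a
    well-defined module map. *)
Lemma hook2_rel_act a b : hook2_rel m a b ->
  ca a (ind F (stream_of (init_tab n m))) = ca b (ind F (stream_of (init_tab n m))).
Proof.
have E : stream_of (init_tab n m) = (fun q => (q < m)%N) by apply/funext => q;
  rewrite stream_of_init_tab.
case=> [|r rn|r rn rm].
- rewrite act1 cyc_action_e -rst_init_tab; apply/funext => b'; rewrite /proj /diag.
  case: eqP => [_|ne]; first by rewrite mul1r.
  by rewrite mul0r /ind asboolF // => Eb; apply: ne; rewrite Eb.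
- rewrite cyc_action_y // E dot_sorted //; apply/funext => b'; by rewrite act0.
- rewrite cyc_action_psi // E psi_sorted //; last by case/andP: rn.
  by apply/funext => b'; rewrite act0.
Qed.

Definition phi (x : S) : stream -> F := presmod_fun ca (ind F (stream_of (init_tab n m))) x.

Lemma phi_z : phi z = ind F (stream_of (init_tab n m)).
Proof. by rewrite -[z]scale1r /phi (presmod_fun_gen hook2_rel_act) act1. Qed.

Lemma phiZ a x : phi (a *: x) = ca a (phi x).
Proof. exact: (presmod_funZ hook2_rel_act). Qed.

Lemma phiD x y b : phi (x + y) b = phi x b + phi y b.
Proof. exact: (presmod_funD hook2_rel_act). Qed.

Lemma ce_z : ce F (K + 1) K (rst (stream_of (init_tab n m))) *: z = z.
Proof.
rewrite rst_init_tab; have := presmod_rel (hook2_e F n (K + 1) K m).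
by rewrite scale1r.
Qed.

Lemma cy_z r : (0 < r <= n)%N -> cy F n (K + 1) K r *: z = 0.
Proof. by move=> rn; have := presmod_rel (hook2_y F (K + 1) K m rn); rewrite scale0r. Qed.

Lemma cpsi_z r : (0 < r < n)%N -> r != m -> cpsi F n (K + 1) K r *: z = 0.
Proof. by move=> rn rm; have := presmod_rel (hook2_psi F (K + 1) K rn rm);
  rewrite scale0r. Qed.

Lemma v_hook2_iota : (m < n)%N ->
  v_hook2 F n (K + 1) K m (iota 2 m) = stdvec (cyc_family F n (K + 1) K) z (image_tab n m).
Proof.
move=> mn; rewrite /v_hook2 /stdvec; congr (_ *: _).
rewrite -[RHS]/(tab_op (cyc_family F n (K + 1) K) (nseq m true ++ nseq (n - m).-1 false)
  2 1).
rewrite tab_op_shift add1n; apply: eq_big_nat => j /andP[j1 jm].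
rewrite nth_iota; last by lia.
by rewrite (_ : 2 + j.-1 = j.+1)%N //; lia.
Qed.

End Hook.

(** * Irreducibility of the image and of the quotient *)

Section Submodules.
Variables (R : pzRingType) (M1 M2 : lmodType R) (f : {linear M1 -> M2}) (z w : M2).
Hypothesis z_gen : forall x, exists a, x = a *: z.
Hypothesis im_w : forall y, y \in im f <-> exists a, y = a *: w.

Lemma irreducible_image : w != 0 ->
  (forall x, x \in im f -> x != 0 -> exists c, w = c *: x) ->
  irreducible_module (submod (im f)).
Proof.
move=> w0 h; have wi : w \in im f by apply/im_w; exists 1; rewrite scale1r.
split; first by exists (exist _ w wi : submod (im f)); apply: contraNneq w0 => E;
  apply/eqP; exact: (congr1 val E).
move=> N; have [[u uN u0]|no] := pselect (exists2 u, u \in N & u != 0); [right | left];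
  last first.
  move=> u uN; apply: contrapT => /eqP u0; apply: no; by exists u.
have [|c Ew] := h (val u) (valP u).
  by apply: contraNneq u0 => E; apply/eqP/val_inj.
move=> x; have /im_w[a Ex] := valP x.
have -> : x = (a * c) *: u by apply: val_inj; rewrite linearZ /= -scalerA -Ew.
exact: rpredZ.
Qed.

Lemma irreducible_quotient : z \notin im f ->
  (forall x, x \notin im f -> exists c, z = c *: x) ->
  irreducible_module (modquot (im f)).
Proof.
move=> z_im h.
have pi0 x : modquot_pi (im f) x = 0 <-> x \in im f.
  have -> : 0 = modquot_pi (im f) 0.
    by apply: (addIr (modquot_pi (im f) 0)); rewrite -modquot_piD !add0r.
  by rewrite modquot_eq subr0.
split; first by exists (modquot_pi (im f) z); apply: contraNneq z_im => /pi0.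
move=> N; have [[u uN u0]|no] := pselect (exists2 u, u \in N & u != 0); [right | left];
  last first.
  move=> u uN; apply: contrapT => /eqP u0; apply: no; by exists u.
move: u uN u0; elim/modquot_ind => x xN x0.
have [|c Ez] := h x; first by apply: contraNN x0 => /pi0 ->.
elim/modquot_ind => y; have [a ->] := z_gen y.
rewrite Ez scalerA -modquot_scaleE; exact: rpredZ xN.
Qed.
End Submodules.

Theorem proposition6p13 (F : fieldType) (e : nat) (he : (3 <= e)%N)
  (n : nat) (hn : (1 <= n)%N) (k1 k2 : 'Z_e)
  (hk : k2 = k1 - 1) (hne : (n != 0 %[mod e])%N)
  (m : nat) (hm : (1 <= m <= n - 1)%N)
  (chi : {linear specht_hook1 F n k1 k2 m -> specht_hook2 F n k1 k2 m})
  (hchi : chi (z_hook1 F n k1 k2 m) = v_hook2 F n k1 k2 m (iota 2 m)) :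
  irreducible_module (submod (im chi)) /\ irreducible_module (modquot (im chi)).
Proof.
have Ek : k1 = k2 + 1 by rewrite hk subrK.
clear hk; subst k1.
have n_anchor : n%:R != 0 :> 'Z_e.
  apply: contraNneq hne => /(congr1 (@nat_of_ord _)); rewrite val_Zp_nat; last by lia.
  by rewrite mod0n /= => ->.
have [m_gt0 m_lt_n] : (0 < m)%N /\ (m < n)%N by lia.
have m_le_n := ltnW m_lt_n.
set g := cyc_family F n (k2 + 1) k2; set z := z_hook2 F n (k2 + 1) k2 m.
pose w := stdvec g z (image_tab n m).
have z_gen x : exists a, x = a *: z := presmod_cyclic x.
(* The source of chi is cyclic, so the image is generated by the image of its generator. *)
have im_w y : y \in im chi <-> exists a, y = a *: w.
  split=> [/asboolP[x <-]|[a ->]].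
    have [a ->] := presmod_cyclic x; exists a.
    by rewrite linearZ /= -/(z_hook1 F n (k2 + 1) k2 m) hchi v_hook2_iota.
  apply/asboolP; exists (a *: z_hook1 F n (k2 + 1) k2 m).
  by rewrite linearZ /= hchi v_hook2_iota.
have rho_e : forall i, cyc_action F he k2 hn (gce g i)
  = @proj F e n k2 i := cyc_action_e F he k2 hn.
have rho_y : forall r, (0 < r <= n)%N -> cyc_action F he k2 hn (gcy g r) = @dot_op F e r :=
  @cyc_action_y F e n he k2 hn.
have rho_psi : forall r, (0 < r < n)%N ->
  cyc_action F he k2 hn (gcpsi g r) = @psi_op F e r :=
  @cyc_action_psi F e n he k2 hn.
have ez := ce_z F he hn k2 m_le_n.
have yz := @cy_z F e n k2 m.
have pz := @cpsi_z F e n k2 m.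
have fz := phi_z F he hn k2 m_le_n.
have fZ := @phiZ F e n he hn k2 m m_le_n.
have fD := @phiD F e n he hn k2 m m_le_n.
split.
- apply: (irreducible_image im_w).
    exact: (stdvec_image_tab_neq0 (g := g) he n_anchor m_gt0 m_lt_n rho_psi fz fZ).
  move=> x /im_w xw x0.
  exact: (gen_image_irr (g := g) he n_anchor m_gt0 m_lt_n ez yz pz z_gen
            rho_e rho_y rho_psi fz fZ fD xw x0).
- apply: (irreducible_quotient z_gen).
    apply/negP => /im_w.
    exact: (z_notin_image (g := g) he n_anchor m_gt0 m_lt_n rho_e rho_y rho_psi fz fZ).
  move=> x xw.
  apply: (gen_quotient_irr (g := g) he n_anchor m_gt0 m_lt_n ez yz pz z_gen
            rho_e rho_y rho_psi fz fZ fD) => /im_w.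
  exact/negP.
Qed.
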